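(* Let $G$ be a finite simple planar graph that contains no cycle of length $4$ (as a subgraph) and has maximum degree $\Delta \geq 7$. Then $G$ has an equitable $\Delta$-coloring.
   Context: An equitable $k$-coloring of a graph is a proper vertex coloring with $k$ colors such that the sizes of every two color classes differ by at most $1$. *)

(* Defs.v *)
From mathcomp Require Import all_boot all_order all_algebra.
From mathcomp Require Import mathcomp_extra boolp classical_sets functions.
From mathcomp Require Import set_interval reals interval_inference topology.
From mathcomp Require Import normedtype.

Set Implicit Arguments.
Unset Strict Implicit.
Unset Printing Implicit Defensive.

Import Order.TTheory GRing.Theory Num.Theory.
Import numFieldNormedType.Exports.

(* A finite simple graph is a symmetric irreflexive e : rel T on T : finType. *)

Section Graphs.
Variables (T : finType) (e : rel T).

Definition degree (v : T) : nat := #|[pred w | e v w]|.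

Definition max_degree : nat := \max_(v : T) degree v.

(* Subgraphs need not be induced: chords are allowed. *)
Definition has_cycle_of_length (n : nat) : Prop :=
  exists s : seq T, size s = n /\ ucycle e s.

Definition proper_coloring (k : nat) (c : T -> 'I_k) : Prop :=
  forall u v : T, e u v -> c u != c v.

Definition color_class_size (k : nat) (c : T -> 'I_k) (i : 'I_k) : nat :=
  #|[pred v | c v == i]|.

(* Color classes may be empty; i and j range over all ordered pairs, so the
   one-sided bound says that any two class sizes differ by at most 1. *)
Definition equitable_coloring (k : nat) (c : T -> 'I_k) : Prop :=
  proper_coloring c /\
  forall i j : 'I_k, color_class_size c i <= (color_class_size c j).+1.

Definition equitably_colorable (k : nat) : Prop :=
  exists c : T -> 'I_k, equitable_coloring c.

End Graphs.

Local Open Scope classical_set_scope.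
Local Open Scope ring_scope.

(* Any R : realType is a model of the real line, so R * R with its product
   topology is the plane. An arc is a homeomorphic image of [0, 1]; by
   compactness a continuous injection of [0, 1] is enough. *)
Definition is_arc (R : realType) (A : set (R * R)) (a b : R * R) : Prop :=
  exists f : R -> R * R,
    [/\ {within `[0, 1], continuous f},
        {in `[0, 1] &, injective f},
        f 0 = a, f 1 = b & A = f @` `[0, 1]].

(* A plane drawing: vertex v is the point p v and the edge uv is the arc A u v,
   which contains no vertex other than its ends and meets any other edge only
   in vertices (hence only in common ends). *)
Definition plane_drawing (R : realType) (T : finType) (e : rel T)
    (p : T -> R * R) (A : T -> T -> set (R * R)) : Prop :=
  [/\ injective p,
      forall u v, e u v -> A u v = A v u /\ is_arc (A u v) (p u) (p v),
      forall u v w, e u v -> A u v (p w) -> w = u \/ w = v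
    & forall u v x y, e u v -> e x y ->
        (x, y) <> (u, v) -> (x, y) <> (v, u) ->
        A u v `&` A x y `<=` range p].

Definition planar (R : realType) (T : finType) (e : rel T) : Prop :=
  exists (p : T -> R * R) (A : T -> T -> set (R * R)), plane_drawing e p A.

(* Main.v *)
(* Two consequences of planarity suffice. A plane drawing is approximated by
   walks in the square lattice such that walks of different edges meet only near
   a common end. In the lattice every closed mod-2 chain is the coboundary of a
   set of squares; contracting the walks turns the squares into a family of even
   edge sets that spans the cycle space and covers no edge more than twice.
   Without 4-cycles an even set is a triangle or has at least 5 edges, at least
   6 in a bipartite graph, and triangles are edge-disjoint. Counting gives
   7e <= 15(n - 1), and 2e <= 3(n - 1) for bipartite subgraphs.

   Let m be the maximum degree and n = mt. A vertex x of least positive degree has degree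
   at most 4. Colour the graph without the edges at x by induction and remove x
   from its class V. If x has no neighbour in a class from which a chain of moves
   leads to V, shifting along the chain finishes. Otherwise, for the a <= 4
   classes from which V can be reached, every vertex outside them has a neighbour
   in each, and the edge bounds leave only a = 1 and a = 2. Then V can be
   completed to an independent t-set meeting so many edges that the rest is
   sparse enough to be coloured with one colour less. After at most three such
   steps about t edges remain on (m - 3)t vertices, and any proper colouring of
   those can be balanced. If m does not divide n, vertices of degree at most 4
   are removed, or a clique on at most 3 vertices is added. *)

Require Import Defs.
From mathcomp Require Import all_boot all_order all_algebra reals.
From mathcomp Require Import boolp zify lra.
From mathcomp Require mathcomp_extra classical_sets functions set_interval.
From mathcomp Require interval_inference topology normedtype.

Set Implicit Arguments.
Unset Strict Implicit.
Unset Printing Implicit Defensive.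

(** * Lattice walks *)

(** Faces come from duality rather than topology: a face is a class of lattice squares that no mod-2
    function constant off the drawing can tell apart, so no separation theorem for curves enters. In
    the colouring part the obstacle is a = 1. One neighbour in V for each outside vertex is
    compatible with the edge bounds, and V is one vertex short of a class. The way out is a trade.
    Deleting V removes at least one edge for each outside vertex, while completing V by a swap
    returns at most m - 2 edges. In this case m < t follows from the degree bound, so the price is
    small and the rest has fewer edges per vertex than before. Only the degree and edge bounds and
    the absence of 4-cycles are carried along, because all of them pass to subgraphs with edges
    deleted, which the induction on edges needs. *)

Lemma walk_shorten (T : eqType) (r : rel T) (x : T) (s1 s2 : seq T) :
  path r x (s1 ++ s2) ->
  exists p1 p2, [/\ {subset p1 <= s1}, {subset p2 <= s2}, path r x (p1 ++ p2),
    uniq (x :: p1 ++ p2) & last x (p1 ++ p2) = last x (s1 ++ s2)].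
Proof.
have [n] := ubnP (size (s1 ++ s2)); elim: n x s1 s2 => // n IH x s1 s2.
have [|xs1] := boolP (x \in s1).
  case/splitPr=> a b; rewrite -catA cat_path /= => sz /and3P[_ _ pth].
  have [|p1 [p2 [i1 i2 pp up lp]]] := IH x b s2 _ pth.
    by move: sz; rewrite !size_cat /= size_cat; lia.
  exists p1, p2; split=> //; last by rewrite lp !last_cat /= last_cat.
  by move=> z /i1 zb; rewrite mem_cat inE zb !orbT.
(* A return to [x] in the second part discards the whole first part, so [p1] may come out empty. The
   two parts are kept apart because each half walk has to stay among the cells of its own half
   arc. *)
have [|xs2] := boolP (x \in s2).
  case/splitPr=> a b; rewrite catA cat_path /= => sz /and3P[_ _ pth].
  have [|p1 [p2 [i1 i2 pp up lp]]] := IH x [::] b _ pth.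
    by move: sz; rewrite !size_cat /= ; lia.
  exists p1, p2; split=> //; first by move=> z /i1.
    by move=> z /i2 zb; rewrite mem_cat inE zb !orbT.
  by rewrite lp !last_cat.
case: s1 xs1 => [|y s1] xs1.
  case: s2 xs2 => [|y s2] xs2 sz /=; first by exists [::], [::].
  move=> /andP[rxy pth].
  have [p1 [p2 [i1 i2 pp up lp]]] := IH y [::] s2 sz pth.
  have p10 : p1 = [::] by case: p1 i1 {pp up lp} => // a p1 /(_ a); rewrite inE eqxx => /(_ isT).
  rewrite p10 /= in pp up lp.
  have ysub : {subset y :: p2 <= y :: s2}.
    by move=> z; rewrite !inE => /orP[->//|/i2 ->]; rewrite orbT.
  exists [::], (y :: p2); split=> //=; first by rewrite rxy.
  by rewrite up andbT; apply: contra xs2 => /ysub.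
move=> sz /= /andP[rxy pth].
have [p1 [p2 [i1 i2 pp up lp]]] := IH y s1 s2 sz pth.
have ysub : {subset y :: p1 <= y :: s1}.
  by move=> z; rewrite !inE => /orP[->//|/i1 ->]; rewrite orbT.
exists (y :: p1), p2; split=> //=; first by rewrite rxy.
move: up => /= ->; rewrite andbT -cat_cons mem_cat negb_or; apply/andP; split.
  by apply: contra xs1 => /ysub.
by apply: contra xs2 => /i2.
Qed.

Definition ladj (p q : nat * nat) : bool :=
  ((p.2 == q.2) && ((p.1.+1 == q.1) || (q.1.+1 == p.1))) ||
  ((p.1 == q.1) && ((p.2.+1 == q.2) || (q.2.+1 == p.2))).

Lemma path_uniq_adj (s : seq (nat * nat)) x :
  path (fun p q => (p == q) || ladj p q) x s -> uniq (x :: s) -> path ladj x s.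
Proof.
elim: s x => //= y s IH x /andP[rxy pth] /andP[xys us].
rewrite IH // andbT; case/orP: rxy => // /eqP xy.
by rewrite xy inE eqxx in xys.
Qed.

(* The half walk of an edge e at its end en e b is H e b; the two half walks
   are listed along the edge, from en e false to en e true. *)
Definition lattice_drawing (E T : finType) (en : E -> bool -> T) : Prop :=
  exists (H : E -> bool -> seq (nat * nat)) (c : T -> nat * nat),
  [/\ forall e, exists2 s, H e false = c (en e false) :: s &
         exists s', H e true = rcons s' (c (en e true)),
      forall e, uniq (H e false ++ H e true) /\ sorted ladj (H e false ++ H e true),
      forall e b z, z \in H e b -> 0 < z.1 /\ 0 < z.2
    & forall e e' b b' z, z \in H e b -> z \in H e' b' -> en e b = en e' b'].

(* A simple graph is given by a type of edges; en x false and en x true are the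
   ends of x. *)
Definition simple_edges (E T : finType) (en : E -> bool -> T) : Prop :=
  (forall x, en x false <> en x true) /\
  (forall x y b, en x false = en y b -> en x true = en y (~~ b) -> x = y).

(** * Lattice approximation of plane drawings *)

Section PlaneTopology.
Import mathcomp_extra classical_sets functions set_interval.
Import interval_inference topology normedtype.
Import Order.TTheory GRing.Theory Num.Theory.
Import numFieldNormedType.Exports.
Local Open Scope classical_set_scope.
Local Open Scope ring_scope.

(** * Compactness in the plane *)

Section ArcTopology.
Variable R : realType.
Implicit Types (x y : R * R) (A B : set (R * R)) (f : R -> R * R).

Definition close (r : R) x y := `|x.1 - y.1| < r /\ `|x.2 - y.2| < r.

Lemma ball_close (r : R) x y : ball x r y <-> close r x y.
Proof. by rewrite /ball /= /prod_ball -!ball_normE /ball_ /=. Qed.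

Lemma closeC (r : R) x y : close r x y -> close r y x.
Proof. by move=> [? ?]; split; rewrite distrC. Qed.

Lemma close_trans (r s : R) x y z : close r x y -> close s y z -> close (r + s) x z.
Proof. by rewrite -!ball_close; apply: ball_triangle. Qed.

Lemma closeW (r s : R) x y : r <= s -> close r x y -> close s x y.
Proof. by move=> rs [? ?]; split; apply: lt_le_trans rs. Qed.

(** Each point of [A] has a radius that works in a neighbourhood; the near-covering form of
    compactness, with the filter of small positive radii, makes one radius serve all of [A]. *)
Lemma compact_separation A B : compact A -> compact B -> A `&` B = set0 ->
  exists2 r : R, 0 < r & forall x y, A x -> B y -> ~ close r x y.
Proof.
move=> cA cB AB0.
have clB : closed B by apply: compact_closed => //; apply: norm_hausdorff.
have opB : open (~` B) by apply: closed_openC.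
move/compact_near_coveringP: cA.
move=> /(_ R 0^'+ (fun r x => forall y, B y -> ~ close r x y)) [].
  move=> x Ax.
  have nBx : (~` B) x by move=> Bx; have : (A `&` B) x by []; rewrite AB0.
  have /nbhs_ballP[e /= e0 eB] : nbhs x (~` B) by apply: open_nbhs_nbhs.
  exists (ball x (e / 2), [set r : R | r < e / 2]) => /=.
    split; first by apply: nbhsx_ballx; rewrite divr_gt0.
    by apply: nbhs_right_lt; rewrite divr_gt0.
  move=> [x' r] /= [bx re] y By /ball_close xy.
  suff : (~` B) y by [].
  apply: eB; rewrite [e]splitr; apply: ball_triangle bx _.
  by apply: (le_ball (ltW re)).
move=> r /= r0 H; exists (r / 2); first by rewrite divr_gt0.
move=> x y Ax; apply: H => //=; last by rewrite divr_gt0.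
by rewrite sub0r normrN gtr0_norm ?divr_gt0// ltr_pdivrMr// ltr_pMr// ltr1n.
Qed.

Lemma segment_uniform_continuity f (a b : R) : {within [set` `[a, b]], continuous f} ->
  forall e, 0 < e -> exists2 d : R, 0 < d &
  forall s t, s \in `[a, b]%R -> t \in `[a, b]%R -> `|s - t| < d -> close e (f s) (f t).
Proof.
move=> /subspace_continuousP cf e e0.
have /compact_near_coveringP := @segment_compact R a b.
move=> /(_ R 0^'+ (fun d s => s \in `[a, b] -> forall t, t \in `[a, b]%R -> `|s - t| < d -> close e (f s) (f t))) [].
  move=> s abs.
  have /cvgrPdist_lt/(_ (e / 2)) := cf s abs; rewrite divr_gt0// => /(_ isT).
  rewrite near_withinE => /nbhs_ballP[h /= h0 hB].
  exists (ball s (h / 2), [set r : R | r < h / 2]) => /=.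
    split; first by apply: nbhsx_ballx; rewrite divr_gt0.
    by apply: nbhs_right_lt; rewrite divr_gt0.
  move=> [s' d] /= [bs dh] abs' t abt st.
  have close_f z : ball s h z -> z \in `[a, b] -> close (e / 2) (f s) (f z).
    by move=> sz abz; have := hB z sz abz; rewrite -ball_close -ball_normE.
  have hs : close (e / 2) (f s) (f s').
    apply: close_f => //.
    by apply: le_ball bs; rewrite ler_pdivrMr// ler_pMr// ler1n.
  have ht : close (e / 2) (f s) (f t).
    apply: close_f => //.
    rewrite [h]splitr; apply: ball_triangle bs _.
    by rewrite -ball_normE /=; apply: lt_trans dh.
  by rewrite [e]splitr; apply: close_trans ht; apply: closeC.
move=> r /= r0 H; exists (r / 2); first by rewrite divr_gt0.
move=> s t abs abt st; apply: (H (r / 2)) => //=; last by rewrite divr_gt0.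
by rewrite sub0r normrN gtr0_norm ?divr_gt0// ltr_pdivrMr// ltr_pMr// ltr1n.
Qed.

End ArcTopology.

Section LatticeApproximation.
Variable R : realType.

Lemma finite_common_radius (I : finType) (P : I -> R -> Prop) :
  (forall i, exists2 r, 0 < r & P i r) ->
  (forall i (r s : R), s <= r -> P i r -> P i s) ->
  exists2 r, 0 < r & forall i, P i r.
Proof.
move=> Pex Pmon.
suff [r r0 Pr] : exists2 r, 0 < r & forall i, i \in enum I -> P i r.
  by exists r => // i; apply: Pr; rewrite mem_enum.
elim: (enum I) => [|i s [r r0 Pr]]; first by exists 1.
have [r' r'0 Pr'] := Pex i.
exists (Num.min r r'); first by rewrite lt_min r0.
move=> j; rewrite inE => /orP[/eqP->|js].
  by apply: Pmon Pr'; rewrite ge_min lexx orbT.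
by apply: Pmon (Pr _ js); rewrite ge_min lexx.
Qed.

Section Cells.
Variables (B h : R).
Hypothesis h0 : 0 < h.

(** The shift by [B] makes truncation act as a floor on [-B, B]; the successor keeps the cells off
    the coordinate axes. *)
Definition cell (x : R) : nat := (Num.truncn ((x + B) / h)).+1.

Lemma cell_eq x y : `|x| <= B -> `|y| <= B -> cell x = cell y -> `|x - y| < h.
Proof.
rewrite !ler_norml => /andP[x1 x2] /andP[y1 y2] [] xy.
have /truncn_itv/andP[] : 0 <= (x + B) / h by apply: divr_ge0; [lra|apply: ltW].
have /truncn_itv/andP[] : 0 <= (y + B) / h by apply: divr_ge0; [lra|apply: ltW].
rewrite xy; set n := Num.truncn _.
rewrite !ler_pdivlMr// !ltr_pdivrMr// -natr1 => a1 a2 a3 a4.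
by rewrite ltr_norml; apply/andP; split; lra.
Qed.

Lemma cell_near x y : `|x| <= B -> `|y| <= B -> `|x - y| < h ->
  (cell x <= (cell y).+1)%N.
Proof.
rewrite !ler_norml => /andP[x1 x2] /andP[y1 y2]; rewrite ltr_norml => /andP[xy1 xy2].
have xge : 0 <= (x + B) / h by apply: divr_ge0; [lra|apply: ltW].
have yge : 0 <= (y + B) / h by apply: divr_ge0; [lra|apply: ltW].
rewrite /cell !ltnS truncn_le_nat.
have /andP[_ ] := truncn_itv yge.
rewrite !ltr_pdivrMr// -!natr1; set n := (Num.truncn _)%:R => H.
by lra.
Qed.

End Cells.

(** Arcs with a common end cannot be separated by a distance. Half arcs of different edges that
    belong to different vertices are disjoint and compact, so they can. *)
Definition half_arc (g : R -> R * R) (b : bool) : set (R * R) :=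
  g @` (if b then [set` `[1/2, 1]%R] else [set` `[0, 1/2]%R]).

Lemma half_arc_compact (g : R -> R * R) (b : bool) : {within [set` `[0, 1]%R], continuous g} ->
  compact (half_arc g b).
Proof.
move=> cg; apply: continuous_compact; last by case: b; apply: segment_compact.
apply: continuous_subspaceW cg => x; case: b; rewrite /= !in_itv /= => /andP[? ?];
  apply/andP; split; lra.
Qed.

Lemma lattice_step (a b c : nat) : (a <= b.+1)%N -> (b <= a.+1)%N ->
  (((a, c) == (b, c)) || ladj (a, c) (b, c)) * (((c, a) == (c, b)) || ladj (c, a) (c, b)).
Proof. by rewrite /ladj !xpair_eqE /= eqxx /= !andbT; split; lia. Qed.

(** A lattice point common to two half walks takes its abscissa from [x] and [x'] and its ordinate
    from the nearby points [y] and [y']; the detour costs the factor 3. *)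
Lemma close_chain (h : R) (x y x' y' : R * R) : `|x.1 - x'.1| < h ->
  `|x.2 - y.2| < h -> `|y.2 - y'.2| < h -> `|y'.2 - x'.2| < h -> close (h * 3) x x'.
Proof.
rewrite /close !ltr_norml => /andP[? ?] /andP[? ?] /andP[? ?] /andP[? ?].
by split; apply/andP; split; lra.
Qed.

Lemma leq_mul2_split (N k : nat) : (k <= 2 * N)%N -> (k <= N)%N \/ (N <= k <= 2 * N)%N.
Proof. lia. Qed.

Lemma half_index (N a i : nat) (b : bool) : (if b then a == N else a == 0)%N ->
  (a <= i)%N -> (i < a + N)%N ->
  [/\ if b then N <= i <= 2 * N else i <= N, if b then N <= i.+1 <= 2 * N else i.+1 <= N
    & i.+1 <= 2 * N]%N.
Proof. by case: b => /eqP -> ? ?; split; lia. Qed.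

Lemma dyadic_samples (d : R) : 0 < d -> exists (N : nat) (t : nat -> R),
  [/\ t 0 = 0, t (2 * N)%N = 1, forall k, `|t k.+1 - t k| < d &
   (forall k, (k <= N)%N -> t k \in `[0, 1/2]%R) /\
   (forall k, (N <= k <= 2 * N)%N -> t k \in `[1/2, 1]%R)].
Proof.
move=> d0; pose N := (Num.truncn d^-1).+1; exists N.
have N0 : 0 < N%:R :> R by rewrite ltr0n.
have Nd : N%:R^-1 < d by rewrite invf_plt ?posrE// truncnS_gt.
exists (fun k => k%:R / (2 * N)%:R).
have tN0 : 0 < (2 * N)%:R :> R by rewrite natrM mulr_gt0.
split.
- by rewrite mul0r.
- by rewrite divff// gt_eqF.
- move=> k; rewrite -mulrBl -natrB// subSnn mul1r ger0_norm ?invr_ge0 ?ler0n//.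
  by apply: le_lt_trans Nd; rewrite lef_pV2 ?posrE// ler_nat leq_pmull.
split=> k.
  move=> kN; rewrite in_itv /= divr_ge0 ?ler0n//= ler_pdivrMr// natrM.
  have : k%:R <= N%:R :> R by rewrite ler_nat.
  by lra.
move=> /andP[Nk kN]; rewrite in_itv /=; apply/andP; split.
  rewrite ler_pdivlMr// natrM.
  have : N%:R <= k%:R :> R by rewrite ler_nat.
  by lra.
by rewrite ler_pdivrMr// mul1r ler_nat.
Qed.

Lemma lattice_of_arcs (E T : finType) (en : E -> bool -> T)
    (g : E -> R -> R * R) (p : T -> R * R) :
  (forall e, {within [set` `[0, 1]%R], continuous (g e)}) ->
  (forall e, g e 0 = p (en e false)) -> (forall e, g e 1 = p (en e true)) ->
  (forall e, ~ half_arc (g e) false (p (en e true))) ->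
  (forall e e' b b', e != e' -> en e b <> en e' b' ->
    half_arc (g e) b `&` half_arc (g e') b' = set0) ->
  lattice_drawing en.
Proof.
move=> cg g0 g1 gend gdisj.
(* This radius keeps the first half of an edge away from its far end, so that the second half walk
   is not lost in the shortening. *)
have [r1 r10 sep1] : exists2 r : R, 0 < r & forall e x, half_arc (g e) false x ->
    ~ close r x (p (en e true)).
  apply: finite_common_radius => [e|e r s sr H x Hx xe]; last first.
    by apply: (H x Hx); apply: closeW sr xe.
  have [|r r0 H] := compact_separation (@half_arc_compact _ false (cg e)) (@compact_set1 _ (p (en e true))).
    by rewrite -subset0 => x [Hx /= xe]; apply: (gend e); rewrite -xe.
  by exists r => // x Hx; apply: H.
have [r2 r20 sep2] : exists2 r : R, 0 < r & forall i : (E * E) * (bool * bool),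
    i.1.1 != i.1.2 -> en i.1.1 i.2.1 <> en i.1.2 i.2.2 ->
    forall x y, half_arc (g i.1.1) i.2.1 x -> half_arc (g i.1.2) i.2.2 y ->
    ~ close r x y.
  apply: finite_common_radius => [[[e e'] [b b']]|i r s sr H ne nen x y Hx Hy xy]; last first.
    by apply: (H ne nen x y Hx Hy); apply: closeW sr xy.
  have [/= [ne nen]|nH] := pselect (e != e' /\ en e b <> en e' b'); last first.
    by exists 1 => //= ? ?; case: nH.
  have [|r r0 H] := compact_separation (@half_arc_compact _ b (cg e)) (@half_arc_compact _ b' (cg e')).
    by apply: gdisj.
  by exists r => // _ _ x y Hx Hy; apply: H.
pose h := Num.min r1 r2 / 3.
have h0 : 0 < h by rewrite divr_gt0// lt_min r10.
have h1 : h * 3 <= r1 by rewrite divfK ?ge_min ?lexx// pnatr_eq0.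
have h2 : h * 3 <= r2 by rewrite divfK ?ge_min ?lexx ?orbT// pnatr_eq0.
have [d d0 gd] : exists2 d : R, 0 < d & forall e s t, s \in `[0, 1]%R ->
    t \in `[0, 1]%R -> `|s - t| < d -> close h (g e s) (g e t).
  apply: finite_common_radius => [e|e r s sr H x y x01 y01 xy]; last first.
    by apply: H => //; apply: lt_le_trans sr.
  by apply: segment_uniform_continuity.
have [N [t [t0 t1 tstep [thalf1 thalf2]]]] := dyadic_samples d0.
have t01 k : (k <= 2 * N)%N -> t k \in `[0, 1]%R.
  case/(leq_mul2_split (N := N)) => [/thalf1|/thalf2]; rewrite !in_itv /= => /andP[? ?];
    apply/andP; split; lra.
have [B Bb] : exists B : R, forall e k, (k <= 2 * N)%N -> `|(g e (t k)).1| <= B /\ `|(g e (t k)).2| <= B.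
  exists (\sum_(i : E * 'I_(2 * N).+1) (`|(g i.1 (t i.2)).1| + `|(g i.1 (t i.2)).2|)).
  move=> e k; rewrite -ltnS => kN.
  rewrite (bigD1 (e, Ordinal kN)) //=; set S := \sum_(_ | _) _.
  have S0 : 0 <= S by apply: sumr_ge0 => i _; rewrite addr_ge0.
  have := normr_ge0 (g e (t k)).1; have := normr_ge0 (g e (t k)).2.
  by split; lra.
pose C (x : R * R) := (cell B h x.1, cell B h x.2).
pose pt e k := C (g e (t k)).
(* The extra corner splits a diagonal move between neighbouring cells into a horizontal and a
   vertical step, either of which may be trivial. *)
pose step e k := [:: ((pt e k.+1).1, (pt e k).2); pt e k.+1].
pose W e a n := flatten [seq step e k | k <- iota a n].
pose lr p q := (p == q) || ladj p q.
have Wlast e a n : last (pt e a) (W e a n) = pt e (a + n)%N.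
  elim: n a => [|n IH] a /=; first by rewrite addn0.
  by rewrite IH addSnnS.
have Wpath e a n : (a + n <= 2 * N)%N -> path lr (pt e a) (W e a n).
  elim: n a => //= n IH a; rewrite -addSnnS => an; rewrite IH ?andbT//.
  have aN : (a.+1 <= 2 * N)%N by apply: leq_trans an; rewrite leq_addr.
  have [a1 a2] := Bb e a (ltnW aN); have [b1 b2] := Bb e a.+1 aN.
  have [c1 c2] := gd e (t a.+1) (t a) (t01 _ aN) (t01 _ (ltnW aN)) (tstep a).
  have := cell_near h0 a1 b1; rewrite distrC => /(_ c1) k1.
  have := cell_near h0 b1 a1 c1 => k2.
  have := cell_near h0 a2 b2; rewrite distrC => /(_ c2) k3.
  have := cell_near h0 b2 a2 c2 => k4.
  by rewrite /lr /pt /C /= (lattice_step _ k1 k2).1 (lattice_step _ k3 k4).2.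
have Wmem e a n z : z \in W e a n -> exists i, [/\ (a <= i)%N, (i < a + n)%N,
    z.1 = (pt e i.+1).1 & z.2 = (pt e i).2 \/ z.2 = (pt e i.+1).2].
  case/flattenP => s /mapP[k]; rewrite mem_iota => /andP[ak kan] ->.
  by rewrite !inE => /orP[]/eqP->; exists k; split => //; [left|right].
(* The coordinates of a point of a half walk are those of the cells of two
   nearby points of the half arc. *)
have halfmem e (b : bool) z :
    z \in (if b then W e N N else pt e 0 :: W e 0 N) ->
    exists x y, [/\ half_arc (g e) b x /\ half_arc (g e) b y, close h x y \/ x = y,
      `|x.1| <= B /\ `|x.2| <= B, `|y.1| <= B /\ `|y.2| <= B & z = (cell B h x.1, cell B h y.2)].
  have half k : (if b then (N <= k <= 2 * N)%N else (k <= N)%N) -> half_arc (g e) b (g e (t k)).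
    by case: b {z} => Hk; exists (t k) => //=; [apply: thalf2|apply: thalf1].
  have wcase a : (if b then a == N else a == 0)%N -> z \in W e a N -> exists x y,
    [/\ half_arc (g e) b x /\ half_arc (g e) b y, close h x y \/ x = y,
      `|x.1| <= B /\ `|x.2| <= B, `|y.1| <= B /\ `|y.2| <= B & z = (cell B h x.1, cell B h y.2)].
    move=> Ha /Wmem[i [ai iaN z1 z2]].
    have [hi hi1 i2N] := half_index Ha ai iaN.
    have {}hi : half_arc (g e) b (g e (t i)) by apply: half.
    have {}hi1 : half_arc (g e) b (g e (t i.+1)) by apply: half.
    have B1 := Bb e i.+1 i2N; have B2 := Bb e i (ltnW i2N).
    have cl : close h (g e (t i.+1)) (g e (t i)).
      by apply: gd => //; apply: t01 => //; apply: ltnW.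
    case: z2 => z2.
      exists (g e (t i.+1)), (g e (t i)); split=> //; first by left.
      by case: z z1 z2 => ? ? /= -> ->.
    exists (g e (t i.+1)), (g e (t i.+1)); split=> //; first by right.
    by case: z z1 z2 => ? ? /= -> ->.
  case: b half wcase => half wcase; first by apply: wcase.
  rewrite inE => /orP[/eqP->|]; last by apply: wcase.
  have hh := half 0 (leq0n N); have BB := Bb e 0 (leq0n _).
  exists (g e (t 0)), (g e (t 0)); split=> //.
  by right.
have sepW e e' b b' z : e != e' ->
    z \in (if b then W e N N else pt e 0 :: W e 0 N) ->
    z \in (if b' then W e' N N else pt e' 0 :: W e' 0 N) -> en e b = en e' b'.
  move=> ee' /halfmem[x [y [[hx hy] xy [Bx1 Bx2] [By1 By2] ->]]].
  move=> /halfmem[x' [y' [[hx' hy'] xy' [Bx'1 Bx'2] [By'1 By'2]]]] [c1 c2].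
  have d1 := cell_eq h0 Bx1 Bx'1 (congr1 S c1); have d2 := cell_eq h0 By2 By'2 (congr1 S c2).
  have [//|ne] := pselect (en e b = en e' b').
  exfalso; apply: (sep2 ((e, e'), (b, b')) ee' ne x x' hx hx').
  apply: (closeW h2).
  have e1 : `|x.2 - y.2| < h by case: xy => [[] //|->]; rewrite subrr normr0.
  have e2 : `|x'.2 - y'.2| < h by case: xy' => [[] //|->]; rewrite subrr normr0.
  by apply: close_chain d1 e1 d2 _; rewrite distrC.
have Hex e : exists H : bool -> seq (nat * nat),
    [/\ forall b, {subset H b <= if b then W e N N else pt e 0 :: W e 0 N},
     exists s, H false = C (p (en e false)) :: s,
     exists s, H true = rcons s (C (p (en e true))),
     uniq (H false ++ H true) & sorted ladj (H false ++ H true)].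
  have Hp : path lr (pt e 0) (W e 0 N ++ W e N N).
    by rewrite cat_path Wlast add0n !Wpath// ?addnn ?mul2n// add0n -addnn leq_addr.
  have [p1 [p2 [i1 i2 pp up lp]]] := walk_shorten Hp.
  have {}lp : last (pt e 0) (p1 ++ p2) = pt e (2 * N)%N.
    by rewrite lp last_cat Wlast add0n Wlast addnn -mul2n.
  have ptl : pt e (2 * N)%N = C (p (en e true)) by rewrite /pt t1 g1.
  exists (fun b => if b then p2 else pt e 0 :: p1); split=> //.
  - case=> //; move=> z; rewrite !inE => /orP[->//|/i1 ->]; by rewrite orbT.
  - by exists p1; rewrite /pt t0 g0.
  (* If [p2] were empty, the first half walk would reach the cell of the far end, against [sep1]. *)
  - case: (lastP p2) lp => [|s z]; last first.
      by rewrite last_cat last_rcons => ->; exists s; rewrite ptl.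
    rewrite cats0 => lp; exfalso.
    have : last (pt e 0) p1 \in (if false then W e N N else pt e 0 :: W e 0 N).
      have := mem_last (pt e 0) p1; rewrite !inE => /orP[->//|/i1->]; by rewrite orbT.
    rewrite lp ptl => /(halfmem e false)[x [y [[hx hy] xy [Bx1 Bx2] [By1 By2] [c1 c2]]]].
    have [Bp1 Bp2] := Bb e (2 * N)%N (leqnn _).
    rewrite t1 g1 in Bp1 Bp2.
    have d1 := cell_eq h0 Bx1 Bp1 (congr1 S (esym c1)); have d2 := cell_eq h0 By2 Bp2 (congr1 S (esym c2)).
    apply: (sep1 e x hx); apply: (closeW h1).
    have e1 : `|x.2 - y.2| < h by case: xy => [[] //|->]; rewrite subrr normr0.
    by apply: close_chain d1 e1 d2 _; rewrite subrr normr0.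
  - by apply: path_uniq_adj.
have [H HP] := choice Hex.
exists H, (fun v => C (p v)); split.
- by move=> e; have [_ [s ->] [s' ->] _ _] := HP e; exists s => //; exists s'.
- by move=> e; have [] := HP e.
- move=> e b z; have [sub _ _ _ _] := HP e => /sub /halfmem[x [y [_ _ _ _ ->]]].
  by [].
- move=> e e' b b' z; have [sub _ _ un _] := HP e; have [sub' _ _ _ _] := HP e'.
  have [<- {sub'}|ee' /sub zb /sub' zb'] := eqVneq e e'; last by apply: (sepW e e' b b' z).
  move: un; rewrite cat_uniq => /and3P[_ /hasPn un _].
  by case: b; case: b' => // z1 z2; [have := un _ z1; rewrite /= z2|have := un _ z2; rewrite /= z1].
Qed.

End LatticeApproximation.

Section PlanarLattice.

Lemma planar_lattice_drawing (R : realType) (T E : finType) (e : rel T)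
    (en : E -> bool -> T) :
  simple_edges en -> (forall x, e (en x false) (en x true)) ->
  planar R e -> lattice_drawing en.
Proof.
move=> [en_irr en_inj] eE [p [A [p_inj Aarc Avert Adisj]]].
have [g gP] : exists g : E -> R -> R * R, forall x,
    [/\ {within [set` `[0, 1]%R], continuous (g x)},
        {in `[0, 1]%R &, injective (g x)}, g x 0 = p (en x false), g x 1 = p (en x true) &
        A (en x false) (en x true) = g x @` [set` `[0, 1]%R]].
  have /choice[g gP] : forall x, exists f : R -> R * R,
    [/\ {within [set` `[0, 1]%R], continuous f},
        {in `[0, 1]%R &, injective f}, f 0 = p (en x false), f 1 = p (en x true) &
        A (en x false) (en x true) = f @` [set` `[0, 1]%R]].
    by move=> x; have [_ [f [f1 f2 f3 f4 f5]]] := Aarc _ _ (eE x); exists f.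
  by exists g.
have g_end x b : g x (if b then 1 else 0) = p (en x b).
  by have [_ _ g0 g1 _] := gP x; case: b.
have half01 b (t : R) : ([set` if b then `[1/2, 1]%R else `[0, 1/2]%R]) t -> t \in `[0, 1]%R.
  by case: b; rewrite /= !in_itv /= => /andP[? ?]; apply/andP; split; lra.
have half_end x b : ~ half_arc (g x) b (p (en x (~~ b))).
  rewrite -g_end /half_arc => -[t ht]; have [_ ginj _ _ _] := gP x.
  move=> gt; have tE : t = (if ~~ b then 1 else 0).
    apply: ginj gt; first by apply: (half01 b); case: b ht.
    by case: b {ht}; rewrite in_itv /= lexx ler01.
  by move: ht; rewrite tE; case: b {tE gt} => /=; rewrite in_itv /= => /andP[]; lra.
have halfA x b z : half_arc (g x) b z -> A (en x false) (en x true) z.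
  have [_ _ _ _ ->] := gP x; case=> t ht <-; exists t => //.
  by apply: (half01 b); case: b ht.
(* A half arc misses the far end by injectivity. Hence a common point of two half arcs, which is a
   vertex by [Adisj], is the end of both. *)
have vertex_in_half x b w : half_arc (g x) b (p w) -> w = en x b.
  move=> hw; have [] := Avert _ _ w (eE x) (halfA _ _ _ hw); case: b hw => // hw wE.
    by case: (half_end x true); rewrite -wE.
  by case: (half_end x false); rewrite -wE.
apply: (@lattice_of_arcs R E T en g p).
- by move=> x; have [] := gP x.
- by move=> x; rewrite -(g_end x false).
- by move=> x; rewrite -(g_end x true).
- by move=> x; apply: (half_end x false).
- move=> x y b b' xy bb'; rewrite -subset0 => z [zx zy].
  have [w _ zw] : range p z.
    apply: (Adisj _ _ _ _ (eE x) (eE y)); last by split; [apply: halfA zx|apply: halfA zy].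
    + by move=> [h1 h2]; move/eqP: xy; apply; apply: (en_inj x y false).
    + by move=> [h1 h2]; move/eqP: xy; apply; apply: (en_inj x y true).
  apply: bb'; rewrite -zw in zx zy.
  by rewrite -(vertex_in_half _ _ _ zx) (vertex_in_half _ _ _ zy).
Qed.

End PlanarLattice.

End PlaneTopology.

(** * Duality in the square lattice *)

Local Notation point := (nat * nat)%type.
Local Notation "\xor_ ( i <- r ) F" := (\big[addb/false]_(i <- r) F)
  (at level 36, F at level 36, i, r at level 50).

(* The two unit squares incident with the lattice edge pq, each named by its
   lower left corner. Because of the truncated subtractions here and in nbr,
   lattice drawings are kept off the coordinate axes. *)
Definition left_face (p q : point) : point :=
  (minn p.1 q.1 - (p.1 == q.1), minn p.2 q.2 - (p.2 == q.2)).
Definition right_face (p q : point) : point := (minn p.1 q.1, minn p.2 q.2).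

Definition nbr (p : point) (d : bool * bool) : point :=
  match d with
  | (true, true) => (p.1.+1, p.2)
  | (true, false) => (p.1.-1, p.2)
  | (false, true) => (p.1, p.2.+1)
  | (false, false) => (p.1, p.2.-1)
  end.

Definition dirs := [:: (true, true); (true, false); (false, true); (false, false)].

Definition lattice_boundary (x : point -> point -> bool) (p : point) : bool :=
  \xor_(d <- dirs) x p (nbr p d).

Lemma lattice_boundaryE x p : lattice_boundary x p =
  x p (p.1.+1, p.2) (+) x p (p.1.-1, p.2) (+) x p (p.1, p.2.+1) (+) x p (p.1, p.2.-1).
Proof. by rewrite /lattice_boundary !big_cons big_nil addbF !addbA. Qed.

Lemma faceC p q : (left_face p q = left_face q p) * (right_face p q = right_face q p).
Proof. by rewrite /left_face /right_face ![minn q.1 _]minnC ![minn q.2 _]minnC ![q.1 == _]eq_sym ![q.2 == _]eq_sym. Qed.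

Lemma face_right i j : left_face (i, j) (i.+1, j) = (i, j.-1) /\ right_face (i, j) (i.+1, j) = (i, j).
Proof. by rewrite /left_face /right_face /=; split; congr pair; lia. Qed.

Lemma face_up i j : left_face (i, j) (i, j.+1) = (i.-1, j) /\ right_face (i, j) (i, j.+1) = (i, j).
Proof. by rewrite /left_face /right_face /=; split; congr pair; lia. Qed.

Lemma ladjP p q : ladj p q -> exists2 d, d \in dirs & q = nbr p d.
Proof.
case: p q => [i j] [i' j']; rewrite /ladj /= => /orP[]/andP[/eqP <-]/orP[]/eqP <-.
- by exists (true, true).
- by exists (true, false).
- by exists (false, true).
- by exists (false, false).
Qed.

Lemma ladjC p q : ladj p q = ladj q p.
Proof. by rewrite /ladj ![q.2 == _]eq_sym ![q.1 == _]eq_sym ![(_ == p.1) || _]orbC ![(_ == p.2) || _]orbC. Qed.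

Lemma ladj_ind (P : point -> point -> Prop) :
  (forall p q, P p q -> P q p) ->
  (forall i j, P (i, j) (i.+1, j)) -> (forall i j, P (i, j) (i, j.+1)) ->
  forall p q, ladj p q -> P p q.
Proof.
move=> Psym Ph Pv [i j] [i' j'].
by rewrite /ladj /= => /orP[]/andP[/eqP <-]/orP[]/eqP <- //; apply: Psym.
Qed.

(** Each of the four squares around [p] borders two of the four edges at [p], so its value
    cancels. *)
Lemma coboundary_closed (phi : point -> bool) p : 0 < p.1 -> 0 < p.2 ->
  lattice_boundary (fun p q => phi (left_face p q) (+) phi (right_face p q)) p = false.
Proof.
case: p => [[//|i] [//|j]] _ _; rewrite lattice_boundaryE /=.
rewrite ![_ (i.+1, j.+1) (i, j.+1)]faceC ![_ (i.+1, j.+1) (i.+1, j)]faceC.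
rewrite !(face_right _ _).1 !(face_right _ _).2 !(face_up _ _).1 !(face_up _ _).2 /=.
by case: (phi _); case: (phi _); case: (phi _); case: (phi _).
Qed.

(* phi integrates x upwards along each column of squares. *)
Lemma closed_coboundary (x : point -> point -> bool) :
  (forall p q, x p q = x q p) -> (forall p q, x p q -> 0 < p.1 /\ 0 < p.2) ->
  (forall p, 0 < p.1 -> 0 < p.2 -> lattice_boundary x p = false) ->
  exists phi : point -> bool, forall p q, ladj p q ->
    x p q = phi (left_face p q) (+) phi (right_face p q).
Proof.
move=> xC x_pos x_closed.
pose phi (f : point) := \xor_(k <- iota 1 f.2) x (f.1, k) (f.1.+1, k).
have phiS i j : phi (i, j.+1) = phi (i, j) (+) x (i, j.+1) (i.+1, j.+1).
  by rewrite /phi /fst /snd -{1}(addn1 j) iotaD big_cat big_seq1 add1n.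
have x0 p q : (p.1 == 0) || (p.2 == 0) -> x p q = false.
  by move=> p0; apply/negbTE/negP => /x_pos[]; rewrite !lt0n; case/orP: p0 => ->.
exists phi; apply: ladj_ind => [p q IH|i j|i j].
- by rewrite xC IH// !(faceC q p).
- rewrite (face_right _ _).1 (face_right _ _).2 /=; case: j => [|j].
    by rewrite addbb x0// orbT.
  by rewrite phiS addKb.
rewrite (face_up _ _).1 (face_up _ _).2 /=; case: i => [|i]; first by rewrite addbb x0.
(* Vertical edges are treated by induction on the height: closedness at (i+1, j+1) expresses the
   edge above through the edge below and the two horizontal ones. *)
elim: j => [|j IH]; first by rewrite /phi !big_nil x0// orbT.
have := x_closed (i.+1, j.+1) isT isT; rewrite lattice_boundaryE /= => H.
rewrite !phiS; move: H; rewrite (xC _ (i, _)) (xC _ (_, j)) IH /=.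
by case: (x _ _); case: (x _ _); case: (x _ _); case: (phi _); case: (phi _).
Qed.

Lemma xor_eq_seq (U : seq point) (a : point) (b : bool) : uniq U ->
  \xor_(q <- U) ((q == a) && b) = (a \in U) && b.
Proof.
elim: U => [|y U IH] /=; first by rewrite big_nil.
move=> /andP[yU /IH]; rewrite big_cons inE => ->.
by have [<-|] := eqVneq y a; rewrite ?(negbTE yU) ?addbF.
Qed.

(** Off the axes the four neighbours of [p] are distinct, so a duplicate-free list containing the
    support of [x p] counts each of them once. *)
Lemma lattice_boundary_sum (U : seq point) (x : point -> point -> bool) p : uniq U ->
  0 < p.1 -> 0 < p.2 ->
  (forall q, x p q -> ladj p q /\ q \in U) ->
  \xor_(q <- U) x p q = lattice_boundary x p.
Proof.
case: p => [[//|i] [//|j]] uU _ _ xP; rewrite lattice_boundaryE /=.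
have xE q : x (i.+1, j.+1) q = \xor_(d <- dirs) ((q == nbr (i.+1, j.+1) d) && x (i.+1, j.+1) (nbr (i.+1, j.+1) d)).
  rewrite !big_cons big_nil /= addbF.
  case: (boolP (x _ q)) => [/[dup] xq /xP[/ladjP[d _ qE] _]|xq].
    rewrite qE in xq *.
    by case: d xq {qE} => [[] []] /= ->; rewrite !xpair_eqE !eqxx /= ?andbT ?andbF; lia.
  have xqf q' : q == q' -> x (i.+1, j.+1) q' = false by move=> /eqP <-; apply: negbTE.
  by do 4![case: eqP => [/eqP/xqf ->|_] /=].
under eq_bigr do rewrite xE.
rewrite exchange_big /= !big_cons big_nil addbF !xor_eq_seq// /=.
have mem q : (q \in U) && x (i.+1, j.+1) q = x (i.+1, j.+1) q.
  by case: (boolP (x _ _)) => [/xP[_ ->]|]; rewrite ?andbF.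
by rewrite !mem !addbA.
Qed.

(** * A MacLane family for a lattice drawing *)

Definition even_edges (E T : finType) (en : E -> bool -> T) (z : {set E}) : bool :=
  [forall v, ~~ \big[addb/false]_(x in z) ((en x false == v) (+) (en x true == v))].

Section Chain.

Definition chain (s : seq point) := zip s (behead s).

Lemma mem_chain s c : c \in chain s -> c.1 \in s /\ c.2 \in s.
Proof.
case: s => // a s; rewrite /chain /=.
elim: s a => // b s IH a /=; rewrite inE => /orP[/eqP->|/IH[h1 h2]] /=.
  by rewrite !inE !eqxx !orbT.
by rewrite inE h1 inE h2 !orbT.
Qed.

Lemma chain_cat a s b s' :
  chain ((a :: s) ++ b :: s') = chain (a :: s) ++ (last a s, b) :: chain (b :: s').
Proof. by rewrite /chain /=; elim: s a => //= a' s IH a; rewrite IH. Qed.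

Lemma chain_adj s c : sorted ladj s -> c \in chain s -> ladj c.1 c.2.
Proof.
case: s => // a s; rewrite /chain /=.
elim: s a => // b s IH a /= /andP[ab /IH bs]; rewrite inE => /orP[/eqP->//|/bs].
by [].
Qed.

(** The walk as a mod-2 chain of undirected lattice edges, stored as a symmetric function. *)
Definition walk_chain (s : seq point) (p q : point) : bool :=
  \xor_(c <- chain s) ((c == (p, q)) (+) (c == (q, p))).

Lemma walk_chainC s p q : walk_chain s p q = walk_chain s q p.
Proof. by apply: eq_bigr => c _; rewrite addbC. Qed.

Lemma walk_chain_mem s p q : walk_chain s p q -> ((p, q) \in chain s) || ((q, p) \in chain s).
Proof.
apply: contraLR; rewrite negb_or => /andP[n1 n2]; rewrite /walk_chain big1_seq// => c /andP[_ cs].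
by case: eqP cs n1 => [->->//|_ cs _]; case: eqP cs n2 => [->->|].
Qed.

(** The sum telescopes: every inner point of the walk is met by two consecutive steps. *)
Lemma walk_chain_boundary U a s p : uniq U -> {subset a :: s <= U} ->
  \xor_(q <- U) walk_chain (a :: s) p q = (p == a) (+) (p == last a s).
Proof.
move=> uU; rewrite /walk_chain /chain /=; elim: s a => [|b s IH] a sub.
  by rewrite addbb big1_seq// => q _; rewrite big_nil.
have aU : a \in U by apply: sub; rewrite inE eqxx.
have bU : b \in U by apply: sub; rewrite !inE eqxx orbT.
under eq_bigr do rewrite /= big_cons.
rewrite big_split /= IH; last by move=> z zs; apply: sub; rewrite inE zs orbT.
rewrite big_split /=.
under eq_bigr do rewrite xpair_eqE andbC eq_sym.
under [X in _ (+) X (+) _]eq_bigr do rewrite xpair_eqE eq_sym.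
rewrite !xor_eq_seq// aU bU ![_ == p]eq_sym /=.
by rewrite addbA addbK.
Qed.

End Chain.

Lemma xor_symmetric (U : seq point) (P : pred point) (y : point -> point -> bool) :
  (forall p q, y p q = y q p) -> (forall p, y p p = false) ->
  \big[addb/false]_(p <- U | P p) \big[addb/false]_(q <- U | P q) y p q = false.
Proof.
move=> yC y0; elim: U => [|a U IH]; first by rewrite big_nil.
rewrite big_cons; case: ifPn => Pa; last first.
  by under eq_bigr do rewrite big_cons (negbTE Pa).
rewrite big_cons Pa y0; under [X in _ (+) X]eq_bigr do rewrite big_cons Pa yC.
by rewrite big_split /= IH addbF addbb.
Qed.

Lemma xor_eq_seq_cond (U : seq point) (Q : pred point) (a : point) (r : bool) :
  uniq U -> \big[addb/false]_(q <- U | Q q) ((q == a) && r) = (a \in U) && (Q a && r).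
Proof.
move=> uU; rewrite -xor_eq_seq// big_mkcond; apply: eq_bigr => q _.
by case: eqP => [->|_]; case: (Q _); rewrite ?andbF.
Qed.

Lemma xor_eq_seq_pair (U : seq point) (P Q : pred point) (a b : point) (r : bool) :
  uniq U -> a \in U -> b \in U ->
  \big[addb/false]_(p <- U | P p) \big[addb/false]_(q <- U | Q q)
    ((p == a) && (q == b) && r) = [&& P a, Q b & r].
Proof.
move=> uU aU bU; rewrite (eq_bigr (fun p => (p == a) && (Q b && r))); last first.
  move=> p _; under eq_bigr do rewrite andbAC andbC.
  by rewrite xor_eq_seq_cond// bU /=; case: (p == a); rewrite ?andbF.
by rewrite xor_eq_seq_cond// aU.
Qed.

Section Faces.
Variables (E T : finType) (en : E -> bool -> T).
Hypothesis en_simple : simple_edges en.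
Variables (H : E -> bool -> seq point) (c : T -> point).
Hypothesis H_ends : forall e, exists2 s, H e false = c (en e false) :: s &
         exists s', H e true = rcons s' (c (en e true)).
Hypothesis H_path : forall e, uniq (H e false ++ H e true) /\ sorted ladj (H e false ++ H e true).
Hypothesis H_pos : forall e b z, z \in H e b -> 0 < z.1 /\ 0 < z.2.
Hypothesis H_disj : forall e e' b b' z, z \in H e b -> z \in H e' b' -> en e b = en e' b'.

Let walk e := H e false ++ H e true.
(** The lattice edge from [a e] to [b e] joins the two half walks; it is what remains of the walk
    when the half walks at each vertex are contracted. *)
Let a e := last (0, 0) (H e false).
Let b e := head (0, 0) (H e true).

Let a_mem e : a e \in H e false.
Proof. by rewrite /a; have [s -> _] := H_ends e; rewrite /= mem_last. Qed.

Let b_mem e : b e \in H e true.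
Proof. by have [_ _ [s' ]] := H_ends e; rewrite /b => ->; case: s' => [|? ?] /=; rewrite inE eqxx. Qed.

Let walk_chainE e : chain (walk e) = chain (H e false) ++ (a e, b e) :: chain (H e true).
Proof.
have [s h1 [s' h2]] := H_ends e; rewrite /walk /a /b h1 h2 /=.
by case: s' {h2} => [|b' s'] /=; rewrite -chain_cat.
Qed.

Let sup p q := [exists e, ((p, q) \in chain (walk e)) || ((q, p) \in chain (walk e))].

Let supC p q : sup p q = sup q p.
Proof. by apply: eq_existsb => e; rewrite orbC. Qed.

Let ab_sup e : sup (a e) (b e).
Proof. by apply/existsP; exists e; rewrite walk_chainE mem_cat inE eqxx orbT. Qed.

Let sup_adj p q : sup p q -> ladj p q.
Proof.
by case/existsP => e /orP[] /(chain_adj (H_path e).2) //=; rewrite ladjC.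
Qed.

Let U := undup (flatten [seq walk e | e <- enum E]).

Let U_mem e p : p \in walk e -> p \in U.
Proof. by move=> pe; rewrite mem_undup; apply/flattenP; exists (walk e) => //; apply/mapP; exists e => //; rewrite mem_enum. Qed.

Let U_memH e i p : p \in H e i -> p \in U.
Proof. by move=> pe; apply: (@U_mem e); rewrite mem_cat; case: i pe => ->; rewrite ?orbT. Qed.

Let U_walk p : p \in U -> exists e i, p \in H e i.
Proof.
rewrite mem_undup => /flattenP[s /mapP[e _ ->]]; rewrite mem_cat.
by move=> /orP[h|h]; [exists e, false|exists e, true].
Qed.

Let sup_U p q : sup p q -> p \in U /\ q \in U.
Proof. by case/existsP => e /orP[] /mem_chain/= [h1 h2]; split; apply: (U_mem (e := e)). Qed.

Let U_pos p : p \in U -> 0 < p.1 /\ 0 < p.2.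
Proof. by case/U_walk => e [i]; apply: H_pos. Qed.

(** The region of [v], to be contracted to [v]. Regions of different vertices are disjoint by
    [H_disj]. *)
Let reg v p := [exists e, exists i, (en e i == v) && (p \in H e i)].

Let regE e i v p : p \in H e i -> reg v p = (en e i == v).
Proof.
move=> pe; apply/existsP/eqP => [[e' /existsP[i' /andP[/eqP <- pe']]]|<-].
  exact: H_disj pe pe'.
by exists e; apply/existsP; exists i; rewrite eqxx.
Qed.

Let en_neq e : (en e false == en e true) = false.
Proof. by apply/eqP/en_simple.1. Qed.

Let sup_crossing v p q : sup p q -> reg v p -> ~~ reg v q ->
  exists e, (p, q) = (a e, b e) /\ en e false = v \/ (p, q) = (b e, a e) /\ en e true = v.
Proof.
case/existsP => e pq rp rq.
have same i : p \in H e i -> q \in H e i -> False.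
  by move=> pi qi; move: rp rq; rewrite (regE v pi) (regE v qi) => ->.
exists e; case/orP: pq; rewrite walk_chainE mem_cat inE => /or3P[/mem_chain/=[]|/eqP[pE qE]|/mem_chain/=[]].
- by move=> h1 h2; case: (same _ h1 h2).
- left; rewrite pE qE; split=> //; apply/eqP; rewrite -(regE v (a_mem e)) -pE //.
- by move=> h1 h2; case: (same _ h1 h2).
- by move=> h1 h2; case: (same _ h2 h1).
- right; rewrite pE qE; split=> //; apply/eqP; rewrite -(regE v (b_mem e)) -qE //.
- by move=> h1 h2; case: (same _ h2 h1).
Qed.

Let middle_inj e e' : (a e, b e) = (a e', b e') \/ (a e, b e) = (b e', a e') -> e = e'.
Proof.
case=> -[h1 h2].
  apply: (en_simple.2 e e' false); rewrite /=.
    by apply: (H_disj (a_mem e)); rewrite h1.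
  by apply: (H_disj (b_mem e)); rewrite h2.
apply: (en_simple.2 e e' true); rewrite /=.
  by apply: (H_disj (a_mem e)); rewrite h1.
by apply: (H_disj (b_mem e)); rewrite h2.
Qed.

(** Such a [phi] plays the role of a function on the faces of the lattice drawing. *)
Let invariant (phi : point -> bool) :=
  forall p q, ladj p q -> ~~ sup p q -> phi (left_face p q) = phi (right_face p q).

Let jump (phi : point -> bool) p q := phi (left_face p q) (+) phi (right_face p q).

Let jumpC phi p q : jump phi p q = jump phi q p.
Proof. by rewrite /jump !(faceC q p). Qed.

(** Sum the vanishing boundary of the jump chain over the region of [v]. Edges inside the region
    cancel in pairs, and those leaving it are the middle edges of the graph edges at [v]. *)
Lemma invariant_even phi : invariant phi ->
  even_edges en [set e | jump phi (a e) (b e)].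
Proof.
move=> inv; apply/forallP => v; apply/negbT.
pose y p q := sup p q && jump phi p q.
have yC p q : y p q = y q p by rewrite /y supC jumpC.
have y0 p : y p p = false.
  by apply/negbTE; rewrite negb_and; apply/orP; left; apply/negP => /sup_adj; rewrite /ladj; lia.
have uU : uniq U by apply: undup_uniq.
have ybd p : p \in U -> \xor_(q <- U) y p q = false.
  move=> /U_pos[p1 p2]; rewrite lattice_boundary_sum//; last first.
    by move=> q /andP[pq _]; split; [apply: sup_adj|case: (sup_U pq)].
  rewrite -[RHS](coboundary_closed phi p1 p2); apply: eq_big_seq => d d4.
  rewrite /y; case: (boolP (sup _ _)) => //= nsup.
  have ad : ladj p (nbr p d) by case: p p1 p2 {nsup} => [[//|i] [//|j]] _ _; case: d d4 => [[] []] _; rewrite /ladj /=; lia.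
  by rewrite (inv _ _ ad nsup) addbb.
have S0 : \big[addb/false]_(p <- U | reg v p) \xor_(q <- U) y p q = false.
  by rewrite big_seq_cond big1// => p /andP[/ybd].
have : \big[addb/false]_(p <- U | reg v p) \big[addb/false]_(q <- U | ~~ reg v q) y p q = false.
  rewrite -[RHS]S0; under [RHS]eq_bigr do rewrite (bigID (reg v)).
  by rewrite /= big_split /= (xor_symmetric _ _ yC y0).
pose term e p q := ((p == a e) && (q == b e) && (en e false == v))
   (+) ((p == b e) && (q == a e) && (en e true == v)).
have yE p q : reg v p -> ~~ reg v q -> y p q = \big[addb/false]_(e in E) (term e p q && jump phi (a e) (b e)).
  move=> rp rq; rewrite /y; case: (boolP (sup p q)) => [pq|npq] /=; last first.
    rewrite big1// => e _; apply/negbTE/negP => /andP[+ _]; rewrite /term.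
    case: eqP => [pa|_]; case: eqP => [qb|_] /=; try by rewrite pa qb ab_sup in npq.
    all: try (case: eqP => [pb|_] //=; case: eqP => [qa|_] //=; by rewrite pb qa supC ab_sup in npq).
  have [e he] := sup_crossing pq rp rq.
  rewrite (bigD1 e)//= [X in _ (+) X]big1 ?addbF; last first.
    move=> e' ne; apply/negbTE/negP => /andP[+ _]; rewrite /term => ht; move/eqP: ne; apply.
    have : (p, q) = (a e', b e') \/ (p, q) = (b e', a e').
      move: ht; case: eqP => [->|_]; case: eqP => [->|_] /=; auto; case: eqP => [->|_] //; case: eqP => [->|_] //; auto.
    move=> hpq; apply/esym/middle_inj.
    by move: hpq; case: he => -[[-> ->] _] [] [h1 h2];
      first [by left; rewrite h1 h2|by right; rewrite h1 h2].
  have nab : (a e == b e) = false.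
    by apply/eqP => abe; apply: (en_simple.1 e); apply: (H_disj (a_mem e)); rewrite abe.
  rewrite /term; case: he => -[[-> ->] <-]; rewrite !eqxx ?nab ?[b e == a e]eq_sym ?nab //=.
have termE e : \big[addb/false]_(p <- U | reg v p) \big[addb/false]_(q <- U | ~~ reg v q)
    (term e p q && jump phi (a e) (b e)) =
    jump phi (a e) (b e) && ((en e false == v) (+) (en e true == v)).
  set J := jump _ _ _.
  have aU : a e \in U by apply: (U_memH (a_mem e)).
  have bU : b e \in U by apply: (U_memH (b_mem e)).
  rewrite -[RHS](_ : [&& reg v (a e), ~~ reg v (b e) & J && (en e false == v)] (+)
    [&& reg v (b e), ~~ reg v (a e) & J && (en e true == v)] = _); last first.
    rewrite (regE v (a_mem e)) (regE v (b_mem e)).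
    case: (eqVneq (en e false) v) (en_neq e) => [->|_] h; last by case: J; case: (_ == _).
    by rewrite eq_sym h; case: J.
  rewrite -(xor_eq_seq_pair (reg v) (fun q => ~~ reg v q) _ uU aU bU).
  rewrite -(xor_eq_seq_pair (reg v) (fun q => ~~ reg v q) _ uU bU aU).
  rewrite -big_split; apply: eq_bigr => p _.
  rewrite -big_split; apply: eq_bigr => q _ /=; rewrite /term.
  by case: J; rewrite ?andbT ?andbF.
rewrite (eq_bigr (fun p => \big[addb/false]_(e in E) \big[addb/false]_(q <- U | ~~ reg v q)
    (term e p q && jump phi (a e) (b e)))).
  rewrite exchange_big /= => S; rewrite big_mkcond -[RHS]S; apply: eq_bigr => e _.
  by rewrite termE inE; case: (jump _ _ _).
move=> p rp; rewrite exchange_big; apply: eq_bigr => q; exact: yE.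
Qed.

(** The walks of the edges in [z] add up to a closed chain, because the boundary at [c v] is the
    parity of the degree of [v] in [z]. A potential of this chain jumps at a middle edge exactly
    when its graph edge lies in [z]. *)
Lemma even_invariant z : even_edges en z ->
  exists2 phi, invariant phi & z = [set e | jump phi (a e) (b e)].
Proof.
move=> /forallP z_even.
have uU : uniq U by apply: undup_uniq.
pose x p q := \big[addb/false]_(e in z) walk_chain (walk e) p q.
have xC p q : x p q = x q p by apply: eq_bigr => e _; apply: walk_chainC.
have x_sup p q : x p q -> sup p q.
  apply: contraLR => npq; rewrite /x big1// => e _; apply/negbTE.
  by apply: contra npq => /walk_chain_mem pq; apply/existsP; exists e.
have x_bd p : \xor_(q <- U) x p q = false.
  rewrite exchange_big /=.
  rewrite (eq_bigr (fun e => (p == c (en e false)) (+) (p == c (en e true)))); last first.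
    move=> e _; have [s h1 [s' h2]] := H_ends e.
    have wE : walk e = c (en e false) :: s ++ H e true by rewrite /walk h1.
    rewrite wE walk_chain_boundary//; last by rewrite -wE => q; apply: U_mem.
    by rewrite h2 last_cat last_rcons.
  have cH e i : c (en e i) \in H e i.
    have [s h1 [s' h2]] := H_ends e; case: i; first by rewrite h2 mem_rcons inE eqxx.
    by rewrite h1 inE eqxx.
  case: (boolP [exists e, exists i, p == c (en e i)]) => [|/existsPn np]; last first.
    rewrite big1// => e _; have /existsPn npe := np e.
    by rewrite (negbTE (npe false)) (negbTE (npe true)).
  case/existsP => e /existsP[i /eqP ->]; have /negbTE := z_even (en e i).
  rewrite (eq_bigr (fun e' => (c (en e i) == c (en e' false)) (+) (c (en e i) == c (en e' true)))) => // e' _.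
  have cE i' : (en e' i' == en e i) = (c (en e i) == c (en e' i')).
    apply/eqP/eqP => [->//|ceq]; apply: (H_disj (cH e' i')); rewrite -ceq; exact: cH.
  by rewrite !cE.
have x_pos p q : x p q -> 0 < p.1 /\ 0 < p.2 by move=> /x_sup/sup_U[/U_pos].
have [|phi phiP] := closed_coboundary xC x_pos.
  move=> p p1 p2; rewrite -(lattice_boundary_sum uU p1 p2) ?x_bd// => q /x_sup pq.
  by split; [apply: sup_adj|case: (sup_U pq)].
exists phi; first move=> p q pq npq.
  have : phi (left_face p q) (+) phi (right_face p q) = false.
    by rewrite -phiP//; apply: contraNF npq => /x_sup.
  by case: (phi _); case: (phi _).
apply/setP => e; rewrite inE /jump -phiP; last by apply: sup_adj.
have aH e' i : a e \in H e' i -> b e \in H e' i -> False.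
  move=> h1 h2; apply: (en_simple.1 e).
  by rewrite (H_disj (a_mem e) h1) (H_disj (b_mem e) h2).
have half0 e' i : \xor_(d <- chain (H e' i)) ((d == (a e, b e)) (+) (d == (b e, a e))) = false.
  rewrite big1_seq// => -[d1 d2] /andP[_ /mem_chain[/= h1 h2]].
  by case: eqP h1 h2 => [[-> ->] /aH//|_]; case: eqP => [[-> ->] h1 /aH|].
have walk_middle e' : walk_chain (walk e') (a e) (b e) = (e' == e).
  rewrite /walk_chain walk_chainE big_cat big_cons /= !half0 addbF /=.
  have [->|ne] := eqVneq e' e.
    rewrite eqxx; case: eqP => // -[abe _]; case: (aH e true); by rewrite ?abe.
  case: eqP => [abe|_]; first by rewrite (middle_inj (or_introl abe)) eqxx in ne.
  by case: eqP => // abe; rewrite (middle_inj (or_intror abe)) eqxx in ne.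
rewrite /x (eq_bigr (fun e' => e' == e)); last by move=> e' _; apply: walk_middle.
have [ez|nez] := boolP (e \in z).
  by rewrite (bigD1 e)//= eqxx big1// => e' /andP[_ /negbTE].
by rewrite big1// => e' e'z; apply: contraNF nez => /eqP <-.
Qed.

(** Lying in the same face is defined by testing with invariant functions, which avoids any argument
    about connectedness of faces. *)
Let feq f f' := `[< forall phi, invariant phi -> phi f = phi f' >].

Let fc e (i : bool) := if i then right_face (a e) (b e) else left_face (a e) (b e).

Let cls e i : {set E * bool} := [set j | feq (fc e i) (fc j.1 j.2)].

(* Faces are named by the sides of middle edges that they contain. *)
Lemma maclane_faces : exists (F : finType) (fa fb : E -> F),
    (forall phi : F -> bool, even_edges en [set e | phi (fa e) (+) phi (fb e)]) /\
    (forall z, even_edges en z -> exists phi : F -> bool, z = [set e | phi (fa e) (+) phi (fb e)]).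
Proof.
have feq_refl f : feq f f by apply/asboolP.
exists {set E * bool}, (fun e => cls e false), (fun e => cls e true); split.
  move=> phi0; pose psi f := `[< exists e i, feq f (fc e i) /\ phi0 (cls e i) >].
  have psi_fc e i : psi (fc e i) = phi0 (cls e i).
    apply/asboolP/idP => [[e' [i' [/asboolP h]]]|h]; last by exists e, i.
    suff -> : cls e i = cls e' i' by [].
    by apply/setP => j; rewrite !inE; apply/asboolP/asboolP => hj phi inv; rewrite -hj// h.
  have psi_inv : invariant psi.
    move=> p q pq npq; apply/asboolP/asboolP => -[e [i [/asboolP h h0]]]; exists e, i; split=> //;
      by apply/asboolP => phi inv; rewrite -h// (inv p q pq npq).
  have := invariant_even psi_inv; congr (is_true (even_edges en _)).
  by apply/setP => e; rewrite !inE /jump (psi_fc e false) (psi_fc e true).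
move=> z /even_invariant[phi inv ->].
pose phi0 (C : {set E * bool}) := [exists j in C, phi (fc j.1 j.2)].
have phi0E e i : phi0 (cls e i) = phi (fc e i).
  apply/existsP/idP => [[j /andP[]]|h].
    by rewrite inE => /asboolP ->.
  by exists (e, i); rewrite inE feq_refl.
by exists phi0; apply/setP => e; rewrite !inE !phi0E.
Qed.

End Faces.

Lemma lattice_maclane (E T : finType) (en : E -> bool -> T) :
  simple_edges en -> lattice_drawing en ->
  exists (F : finType) (fa fb : E -> F),
    (forall phi : F -> bool, even_edges en [set e | phi (fa e) (+) phi (fb e)]) /\
    (forall z, even_edges en z -> exists phi : F -> bool, z = [set e | phi (fa e) (+) phi (fb e)]).
Proof.
by move=> en_simple [H [c [H_ends H_path H_pos H_disj]]]; apply: (maclane_faces en_simple H_ends).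
Qed.

(** * Edge bounds *)

Section Counting.
Variables (E T : finType) (en : E -> bool -> T).

Definition symdiff (A B : {set E}) := [set x | (x \in A) (+) (x \in B)].

Lemma xor_symdiff (A B : {set E}) (f : E -> bool) :
  \big[addb/false]_(x in symdiff A B) f x =
  \big[addb/false]_(x in A) f x (+) \big[addb/false]_(x in B) f x.
Proof.
rewrite big_mkcond [X in _ = X (+) _]big_mkcond [X in _ = _ (+) X]big_mkcond -big_split /=.
apply: eq_bigr => x _.
by rewrite inE; case: (x \in A); case: (x \in B); case: (f x).
Qed.

Definition odd_vertices (z : {set E}) : {set T} :=
  [set v | \big[addb/false]_(x in z) ((en x false == v) (+) (en x true == v))].

Lemma even_edgesE z : even_edges en z = (odd_vertices z == set0).
Proof.
apply/forallP/eqP => [h|/setP h v]; last by have := h v; rewrite !inE => ->.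
by apply/setP => v; rewrite !inE; apply: negbTE.
Qed.

Lemma odd_vertices_symdiff z z' v :
  (v \in odd_vertices (symdiff z z')) = (v \in odd_vertices z) (+) (v \in odd_vertices z').
Proof. by rewrite !inE xor_symdiff. Qed.

Lemma xor_eq1 (v : T) : \big[addb/false]_(w : T) (v == w) = true.
Proof. by rewrite (bigD1 v)//= eqxx big1// => w /negbTE; rewrite eq_sym. Qed.

Lemma odd_vertices_handshake z : \big[addb/false]_(v : T) (v \in odd_vertices z) = false.
Proof.
under eq_bigr do rewrite inE.
by rewrite exchange_big big1// => x _; rewrite big_split /= !xor_eq1.
Qed.

Lemma even_edges_symdiff z z' :
  even_edges en z -> even_edges en z' -> even_edges en (symdiff z z').
Proof.
rewrite !even_edgesE => /eqP/setP h /eqP/setP h'; apply/eqP/setP => v.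
by rewrite odd_vertices_symdiff h h' !inE.
Qed.

(* Sets of edges with the same odd vertices, up to x0, differ by an even set. *)
Lemma even_edges_count (X : {set T}) (x0 : T) :
  x0 \in X -> (forall e b, en e b \in X) ->
  2 ^ #|E| <= #|[set z | even_edges en z]| * 2 ^ #|X|.-1.
Proof.
move=> x0X enX.
pose g z := odd_vertices z :\ x0.
have gX z : g z \in powerset (X :\ x0).
  rewrite powersetE; apply: setSD; apply/subsetP => v; rewrite inE.
  apply: contraLR => vX; rewrite big1// => e _.
  by case: eqP => [ev|_]; [rewrite -ev enX in vX|case: eqP => // ev; rewrite -ev enX in vX].
have g_even z z' : g z = g z' -> even_edges en (symdiff z z').
  move=> /setP gz; rewrite even_edgesE; apply/eqP/setP => v; rewrite [RHS]inE.
  have h w : w != x0 -> (w \in odd_vertices (symdiff z z')) = false.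
    by move=> wx; have := gz w; rewrite !in_setD1 wx odd_vertices_symdiff /= => ->; rewrite addbb.
  have [->|/h//] := eqVneq v x0.
  have := odd_vertices_handshake (symdiff z z'); rewrite (bigD1 x0)//= big1; last by move=> w /h.
  by rewrite addbF.
rewrite -cardsT -card_powerset powersetT cardsT.
have -> : #|{: {set E}}| = \sum_(Y in powerset (X :\ x0)) #|[set z | g z == Y]|.
  rewrite -[LHS]sum1_card (partition_big g (fun Y => Y \in powerset (X :\ x0))) => [|z _]; last exact: gX.
  by apply: eq_bigr => Y _; rewrite -sum1_card; apply: eq_bigl => z; rewrite inE.
rewrite [X in _ <= X]mulnC (cardsD1 x0 X) x0X add1n -card_powerset -sum_nat_const.
apply: leq_sum => Y _; case: (set_0Vmem [set z | g z == Y]) => [->|[z]]; first by rewrite cards0.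
rewrite inE => /eqP gzY.
rewrite -(@card_in_imset _ _ (symdiff z) [set z | g z == Y]).
  apply: subset_leq_card; apply/subsetP => _ /imsetP[z' + ->]; rewrite !inE => /eqP gz'.
  by apply: g_even; rewrite gzY gz'.
by move=> z1 z2 _ _ /setP h; apply/setP => x; have := h x; rewrite !inE; case: (x \in z); case: (x \in z1); case: (x \in z2).
Qed.

Section Stars.
Variables (F : finType) (fa fb : E -> F).

(** The boundary of a face; an edge with the same face on both sides does not belong to it. *)
Definition star (i : F) : {set E} := [set e | (fa e == i) (+) (fb e == i)].

(** Faces with equal boundaries are merged and empty boundaries dropped. The span is unchanged, and
    every member is nonempty, as the lower bounds on star sizes require. *)
Definition stars : {set {set E}} := [set star i | i in F] :\ set0.

Lemma stars_sum : \sum_(s in stars) #|s| <= 2 * #|E|.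
Proof.
have -> : \sum_(s in stars) #|s| = \sum_(e : E) #|[set s in stars | e \in s]|.
  under eq_bigr do rewrite -sum1_card big_mkcond.
  rewrite exchange_big; apply: eq_bigr => e _ /=.
  rewrite -sum1_card -big_mkcondr; apply: eq_bigl => s; by rewrite inE.
rewrite mulnC -sum_nat_const; apply: leq_sum => e _.
have : [set s in stars | e \in s] \subset [set star (fa e); star (fb e)].
  apply/subsetP => s; rewrite !inE => /andP[/andP[_ /imsetP[i _ ->]]]; rewrite inE.
  by have [->|_] := eqVneq (fa e) i; [rewrite eqxx|have [->|//] := eqVneq (fb e) i; rewrite eqxx orbT].
by move=> /subset_leq_card/leq_trans; apply; rewrite cards2; case: (_ == _).
Qed.

Lemma even_edges_le_stars :
  (forall z, even_edges en z -> exists phi : F -> bool, z = [set e | phi (fa e) (+) phi (fb e)]) ->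
  #|[set z | even_edges en z]| <= 2 ^ #|stars|.
Proof.
move=> span; rewrite -card_powerset.
pose h (P : {set {set E}}) : {set E} := [set e | \big[addb/false]_(s in P) (e \in s)].
apply: leq_trans (leq_imset_card h (powerset stars)).
apply: subset_leq_card; apply/subsetP => z; rewrite inE => /span[phi ->].
(* After merging, a star enters the sum according to the parity of the selected faces that share
   it. *)
pose sel s := \big[addb/false]_(i | star i == s) phi i.
apply/imsetP; exists [set s in stars | sel s].
  by rewrite powersetE; apply/subsetP => s; rewrite inE => /andP[].
apply/setP => e; rewrite !inE.
have <- : \big[addb/false]_(i : F) (phi i && (e \in star i)) = phi (fa e) (+) phi (fb e).
  have one f : \big[addb/false]_(i : F) (phi i && (f == i)) = phi f.
    by rewrite (bigD1 f)//= eqxx andbT big1 ?addbF// => i; rewrite eq_sym => /negbTE ->; rewrite andbF.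
  under eq_bigr do rewrite inE.
  rewrite -[in RHS](one (fa e)) -[in RHS](one (fb e)) -big_split; apply: eq_bigr => i _ /=.
  by case: (phi i).
rewrite (partition_big star (fun s => true))//= big_mkcond [RHS]big_mkcond; apply: eq_bigr => s _ /=.
rewrite (eq_bigr (fun i => (e \in s) && phi i)); last by move=> i /eqP ->; rewrite andbC.
have dist (I : finType) (P : pred I) f (b : bool) :
    \big[addb/false]_(i | P i) (b && f i) = b && \big[addb/false]_(i | P i) f i.
  by case: b => //; apply: big1.
rewrite dist !inE -/(sel s); case: (boolP (s \in star @: F)) => [_|ns]; last first.
  rewrite andbF /sel big_pred0 ?andbF// => i; apply/negbTE; apply: contra ns => /eqP <-.
  exact: imset_f.
rewrite andbT; case: (eqVneq s set0) => [->|_] /=; first by rewrite inE.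
by case: (sel s); rewrite ?andbT ?andbF.
Qed.

End Stars.
End Counting.

Definition C4_free (T : finType) (e : rel T) : Prop :=
  forall u v a b, u != v -> a != b -> e u a -> e u b -> e v a -> e v b -> False.

(** * Even edge sets in graphs without 4-cycles *)

Section EvenSets.
Variables (E T : finType) (en : E -> bool -> T).
Hypothesis en_simple : simple_edges en.

Definition links (x : E) (u v : T) : bool :=
  ((en x false == u) && (en x true == v)) || ((en x false == v) && (en x true == u)).

Lemma linksC x u v : links x u v = links x v u.
Proof. by rewrite /links orbC. Qed.

Lemma links_en x : links x (en x false) (en x true).
Proof. by rewrite /links !eqxx. Qed.

Lemma links_neq x u v : links x u v -> u != v.
Proof.
by case/orP => /andP[/eqP <- /eqP <-]; last rewrite eq_sym; apply/eqP; apply: en_simple.1.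
Qed.

Lemma links_inj x y u v : links x u v -> links y u v -> x = y.
Proof.
rewrite /links => /orP[]/andP[/eqP h1 /eqP h2] /orP[]/andP[/eqP h3 /eqP h4].
- by apply: (en_simple.2 x y false); rewrite /= ?h1 ?h2 ?h3 ?h4.
- by apply: (en_simple.2 x y true); rewrite /= ?h1 ?h2 ?h3 ?h4.
- by apply: (en_simple.2 x y true); rewrite /= ?h1 ?h2 ?h3 ?h4.
- by apply: (en_simple.2 x y false); rewrite /= ?h1 ?h2 ?h3 ?h4.
Qed.

Lemma links_ends x u v w : links x u v ->
  (en x false == w) (+) (en x true == w) = (w == u) || (w == v).
Proof.
move=> l; have uv := links_neq l; move: l uv; rewrite /links.
case/orP => /andP[/eqP <- /eqP <-]; rewrite ![w == _]eq_sym.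
  by case: (eqVneq (en x false) w) => [->|//]; rewrite eq_sym => /negbTE ->.
case: (eqVneq (en x true) w) => [->|_]; last by rewrite addbF.
by rewrite eq_sym => /negbTE ->.
Qed.

Lemma links_other x u v w t : links x u v -> links x w t ->
  (w == u) && (t == v) || (w == v) && (t == u).
Proof.
by rewrite /links => /orP[]/andP[/eqP <- /eqP <-] /orP[]/andP[/eqP <- /eqP <-]; rewrite !eqxx ?orbT.
Qed.

(** No vertex has degree 1 in an even set, so a trail can always be continued. *)
Lemma even_next z x u v : even_edges en z -> x \in z -> links x u v ->
  exists y w, [/\ y \in z, y != x, links y v w & w != u].
Proof.
move=> /forallP/(_ v) ev xz xuv.
case: (boolP [exists y in z, (y != x) && ((en y false == v) || (en y true == v))]) => [|/existsPn none].
  case/existsP => y /and3P[yz yx yv].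
  have [w yw] : exists w, links y v w.
    by case/orP: yv => /eqP <-; [exists (en y true)|exists (en y false)]; rewrite /links !eqxx ?orbT.
  exists y, w; split=> //; apply: contra yx => /eqP wu.
  by apply/eqP; apply: (links_inj _ xuv); rewrite linksC -wu.
move: ev; rewrite (bigD1 x)//= (links_ends _ xuv) eqxx orbT big1// => y /andP[yz yx].
have := none y; rewrite yz yx /= negb_or => /andP[/negbTE -> /negbTE ->] //.
Qed.

Section C4free.
Variable e : rel T.
Hypotheses (e_C4 : C4_free e) (e_sym : symmetric e).
Hypothesis en_e : forall x, e (en x false) (en x true).

Lemma links_e x u v : links x u v -> e u v.
Proof. by case/orP => /andP[/eqP <- /eqP <-]; rewrite // e_sym. Qed.

Definition triangle (z : {set E}) : Prop :=
  exists x y t u v w, [/\ z = [set x; y; t], links x u v, links y v w & links t w u].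

Lemma triangle_card z : triangle z -> #|z| = 3.
Proof.
move=> [x [y [t [u [v [w [-> xuv yvw twu]]]]]]].
have uv := links_neq xuv; have vw := links_neq yvw; have wu := links_neq twu.
have xy : x != y.
  apply/eqP => xy; rewrite -xy in yvw; have := links_other xuv yvw.
  by rewrite eq_sym (negbTE uv) (negbTE wu) andbF.
have xt : x != t.
  apply/eqP => xt; rewrite -xt in twu; have := links_other xuv twu.
  by rewrite (negbTE wu) [w == v]eq_sym (negbTE vw).
have yt : y != t.
  apply/eqP => yt; rewrite -yt in twu; have := links_other yvw twu.
  by rewrite (eq_sym w v) (negbTE vw) (negbTE uv) andbF.
by rewrite -setUA cardsU1 cards2 !inE negb_or xy xt yt.
Qed.

Lemma triangle_even z : triangle z -> even_edges en z.
Proof.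
move=> tz; have := triangle_card tz; move: tz.
move=> [x [y [t [u [v [w [-> xuv yvw twu]]]]]]] c3.
have [/negP xn yt] : ~ x \in [set y; t] /\ y != t.
  by move: c3; rewrite -setUA cardsU1 cards2; case: (x \in _) => //; case: (y != t).
apply/forallP => s; rewrite -setUA big_setU1//= big_setU1 ?inE//= big_set1.
rewrite (links_ends _ xuv) (links_ends _ yvw) (links_ends _ twu).
have uv := links_neq xuv; have vw := links_neq yvw; have wu := links_neq twu.
by have [->|] := eqVneq s u; have [su|] := eqVneq s v; have [sw|] := eqVneq s w => //=;
  rewrite ?(negbTE uv) ?eqxx ?[u == w]eq_sym ?(negbTE wu) //; move: uv vw wu; rewrite -?su -?sw ?eqxx.
Qed.

(* Follow a trail x1 x2 x3 x4 in z: either it closes into a triangle or it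
   needs a fifth edge. *)
Lemma even_edges_card z : even_edges en z -> z != set0 -> triangle z \/ 5 <= #|z|.
Proof.
have small z' : even_edges en z' -> z' != set0 ->
    (exists2 z0, triangle z0 & z0 \subset z') \/ 5 <= #|z'|.
  move=> ev /set0Pn[x1 x1z].
  have l1 := links_en x1; set v0 := en x1 false in l1; set v1 := en x1 true in l1.
  have [x2 [v2 [x2z x21 l2 v20]]] := even_next ev x1z l1.
  have [x3 [v3 [x3z x32 l3 v31]]] := even_next ev x2z l2.
  have [v30|v30] := eqVneq v3 v0.
    left; exists [set x1; x2; x3].
      by exists x1, x2, x3, v0, v1, v2; split=> //; rewrite -v30.
    by apply/subsetP => x; rewrite !inE => /orP[/orP[]|]/eqP ->.
  right; have [x4 [v4 [x4z x43 l4 v42]]] := even_next ev x3z l3.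
  have v40 : v4 != v0.
    apply/eqP => v40; rewrite v40 in l4.
    apply: (e_C4 (u := v0) (v := v2) (a := v1) (b := v3)); rewrite 1?eq_sym //.
    - exact: links_e l1.
    - by rewrite e_sym; apply: links_e l4.
    - by rewrite e_sym; apply: links_e l2.
    - exact: links_e l3.
  have [x5 [v5 [x5z x51 l5 v51]]] := even_next ev x1z (etrans (linksC _ _ _) l1).
  have n01 := links_neq l1; have n12 := links_neq l2; have n23 := links_neq l3; have n34 := links_neq l4.
  have dist x y a b c d : links x a b -> links y c d ->
      ~~ ((c == a) && (d == b) || (c == b) && (d == a)) -> x != y.
    by move=> la lc; apply: contra => /eqP xy; rewrite xy in la; apply: links_other la lc.
  have x13 : x1 != x3.
    by apply: (dist _ _ _ _ _ _ l1 l3); rewrite (negbTE v20) [v2 == v1]eq_sym (negbTE n12).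
  have x14 : x1 != x4.
    by apply: (dist _ _ _ _ _ _ l1 l4); rewrite (negbTE v30) (negbTE v31).
  have x24 : x2 != x4.
    by apply: (dist _ _ _ _ _ _ l2 l4); rewrite (negbTE v31) [v3 == v2]eq_sym (negbTE n23).
  have x52 : x5 != x2.
    by apply: (dist _ _ _ _ _ _ l5 l2); rewrite [v1 == v0]eq_sym (negbTE n01) (negbTE v20) andbF.
  have x53 : x5 != x3.
    by apply: (dist _ _ _ _ _ _ l5 l3); rewrite (negbTE v20) (negbTE v30) andbF.
  have x54 : x5 != x4.
    by apply: (dist _ _ _ _ _ _ l5 l4); rewrite (negbTE v30) (negbTE v40) andbF.
  have : [set x5; x1; x2; x3; x4] \subset z'.
    by apply/subsetP => x; rewrite !inE => /orP[/orP[/orP[/orP[]|]|]|]/eqP ->.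
  move=> /subset_leq_card; apply: leq_trans.
  rewrite -!setUA !cardsU1 cards1 !inE !negb_or x51 x52 x53 x54 [x1 == x2]eq_sym x21 x13 x14.
  by rewrite [x2 == x3]eq_sym x32 x24 [x3 == x4]eq_sym x43.
move=> ev nz; case: (small z ev nz) => [[z0 t0 z0z]|]; last by right.
have [z0E|zd] := eqVneq (z :\: z0) set0.
  left; suff -> : z = z0 by [].
  by apply/eqP; rewrite eqEsubset z0z -setD_eq0 z0E eqxx.
(* The rest is a nonempty even set, so it has at least three edges and [z] has at least six. *)
right.
have evd : even_edges en (z :\: z0).
  rewrite (_ : z :\: z0 = symdiff z z0); first by apply: even_edges_symdiff => //; apply: triangle_even.
  by apply/setP => x; rewrite !inE; have := subsetP z0z x; case: (x \in z0) => [->//|]; case: (x \in z).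
have c0 := triangle_card t0.
have cz : #|z| = 3 + #|z :\: z0| by rewrite -c0 -{1}(setIidPr z0z) cardsID.
have [[z1 t1 /subset_leq_card]|] := small _ evd zd; last by lia.
rewrite (triangle_card t1); lia.
Qed.

(** Two triangles on a common edge with different third vertices would form a 4-cycle with that edge
    as a chord. *)
Lemma triangles_disjoint z z' : triangle z -> triangle z' -> z != z' -> [disjoint z & z'].
Proof.
move=> tz tz'; apply: contraR => /pred0Pn[x0 /= /andP[xz xz']].
have rot s x : triangle s -> x \in s ->
    exists y t w, [/\ s = [set x; y; t], links y (en x true) w & links t w (en x false)].
  have flip a b c u v w : s = [set a; b; c] -> links a u v -> links b v w -> links c w u ->
      exists y t w, [/\ s = [set a; y; t], links y (en a true) w & links t w (en a false)].
    move=> sE la lb lc; case/orP: (la) => /andP[/eqP-> /eqP->]; first by exists b, c, w.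
    by exists c, b, w; rewrite sE -!setUA (setUC [set b]) linksC lc linksC lb.
  move=> [a [b [c [u [v [w [sE la lb lc]]]]]]] xs; have := xs.
  rewrite {1}sE !inE => /orP[/orP[]|]/eqP ->.
  - exact: flip sE la lb lc.
  - by apply: flip lb lc la; rewrite sE -setUA setUC.
  - by apply: flip lc la lb; rewrite sE setUC setUA.
have [y [t [w [-> ly lt]]]] := rot _ _ tz xz.
have [y' [t' [w' [-> ly' lt']]]] := rot _ _ tz' xz'.
have ww : w = w'.
  apply/eqP; apply/negPn/negP => ww.
  have n01 := links_neq (links_en x0).
  apply: (e_C4 (u := en x0 true) (v := en x0 false) (a := w) (b := w')) => //.
  - by rewrite eq_sym.
  - exact: links_e ly.
  - exact: links_e ly'.
  - by rewrite e_sym; apply: links_e lt.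
  - by rewrite e_sym; apply: links_e lt'.
by rewrite ww in ly lt; rewrite (links_inj ly ly') (links_inj lt lt').
Qed.

Section Bounds.
Variables (F : finType) (fa fb : E -> F).
Hypothesis F_even : forall phi : F -> bool, even_edges en [set x | phi (fa x) (+) phi (fb x)].
Hypothesis F_span : forall z, even_edges en z ->
  exists phi : F -> bool, z = [set x | phi (fa x) (+) phi (fb x)].
Variables (X : {set T}) (x0 : T).
Hypotheses (x0X : x0 \in X) (enX : forall x b, en x b \in X).

Lemma star_even i : even_edges en (star fa fb i).
Proof. by have := F_even (pred1 i). Qed.

(** One half of Euler's formula: the cycle space has dimension at least |E| - |X| + 1, and the stars
    span it. *)
Lemma edges_le_stars : #|E| + 1 <= #|stars fa fb| + #|X|.
Proof.
have h := leq_trans (even_edges_count x0X enX)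
  (leq_mul (even_edges_le_stars F_span) (leqnn _)).
have X0 : 0 < #|X| by rewrite (cardD1 x0) x0X.
by move: h; rewrite -expnD leq_exp2l//; lia.
Qed.

Lemma star_cases s : s \in stars fa fb -> triangle s \/ 5 <= #|s|.
Proof.
by rewrite in_setD1 => /andP[s0 /imsetP[i _ sE]]; apply: even_edges_card => //; rewrite sE star_even.
Qed.

(** Triangular stars are edge-disjoint, so at most |E|/3 stars fall short of 5 edges, each by 2.
    Hence f stars satisfy 5 f <= 2 |E| + 2 |E|/3, and [edges_le_stars] finishes. *)
Lemma edge_bound : 7 * #|E| + 15 <= 15 * #|X|.
Proof.
pose t3 := [set s in stars fa fb | #|s| == 3].
have t3_tri s : s \in t3 -> triangle s.
  rewrite inE => /andP[/star_cases[//|h] /eqP h3]; by rewrite h3 in h.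
have tt : 3 * #|t3| <= #|E|.
  have triv : trivIset t3.
    by apply/trivIsetP => s s' /t3_tri ts /t3_tri ts'; apply: triangles_disjoint.
  have <- : #|cover t3| = 3 * #|t3|.
    rewrite -(eqP triv) mulnC -sum_nat_const; apply: eq_bigr => s; rewrite inE.
    by case/andP => _ /eqP.
  exact: max_card.
have ss : 5 * #|stars fa fb| <= \sum_(s in stars fa fb) #|s| + 2 * #|t3|.
  have -> : 2 * #|t3| = \sum_(s in stars fa fb) (if #|s| == 3 then 2 else 0).
    by rewrite mulnC -sum_nat_const -big_mkcondr; apply: eq_bigl => s; rewrite inE.
  rewrite mulnC -sum_nat_const -big_split; apply: leq_sum => s /star_cases[/triangle_card ->//|] /=.
  by move/leq_trans; apply; apply: leq_addr.
have := stars_sum fa fb; have := edges_le_stars; lia.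
Qed.

Lemma bipartite_edge_bound (A : {set T}) :
  (forall x, (en x false \in A) (+) (en x true \in A)) -> 2 * #|E| + 3 <= 3 * #|X|.
Proof.
move=> bip.
(* Every edge has exactly one end in [A], so |z| has the parity of the sum of the degrees in [z]
   over [A]. Stars thus have at least 6 edges. *)
have even_card z : even_edges en z -> ~~ odd #|z|.
  move=> /forallP ev; have : \big[addb/false]_(v in A) \big[addb/false]_(x in z) ((en x false == v) (+) (en x true == v)) = false.
    by rewrite big1// => v _; apply: negbTE.
  rewrite exchange_big /= (eq_bigr (fun _ => true)).
    have -> : \big[addb/false]_(x in z) true = odd #|z|.
      by rewrite -sum1_card (big_morph odd oddD (erefl _)).
    by move=> ->.
  move=> x _; rewrite big_split /= -[RHS](bip x).
  have one v : \big[addb/false]_(w in A) (v == w) = (v \in A).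
    case: (boolP (v \in A)) => vA; first by rewrite (bigD1 v)//= eqxx big1// => w /andP[_ /negbTE]; rewrite eq_sym.
    by rewrite big1// => w wA; apply/negbTE; apply: contra vA => /eqP ->.
  by rewrite !one.
have ss : 6 * #|stars fa fb| <= \sum_(s in stars fa fb) #|s|.
  rewrite mulnC -sum_nat_const; apply: leq_sum => s sS.
  have := sS; rewrite in_setD1 => /andP[_ /imsetP[i _ sE]].
  have := even_card _ (star_even i); rewrite -sE.
  case: (star_cases sS) => [/triangle_card ->//|]; lia.
have := stars_sum fa fb; have := edges_le_stars; lia.
Qed.

End Bounds.
End C4free.
End EvenSets.

(* cnt e X X counts every edge inside X twice. *)
Definition cnt (T : finType) (e : rel T) (X Y : {set T}) : nat :=
  \sum_(u in X) #|[set v in Y | e u v]|.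

Lemma cnt_pairs (T : finType) (e : rel T) (X Y : {set T}) :
  cnt e X Y = #|[pred p : T * T | [&& p.1 \in X, p.2 \in Y & e p.1 p.2]]|.
Proof.
rewrite /cnt -sum1_card (eq_bigl (fun p : T * T => (p.1 \in X) && ((p.2 \in Y) && e p.1 p.2))) //.
rewrite -(pair_big_dep (fun u => u \in X) (fun u v => (v \in Y) && e u v) (fun _ _ => 1)) /=.
by apply: eq_bigr => u _; rewrite -sum1_card; apply: eq_bigl => v; rewrite inE.
Qed.

(** * Edge bounds for planar graphs *)

Section PlanarBounds.
Variables (R : realType) (T : finType) (e : rel T).
Hypotheses (e_sym : symmetric e) (e_irr : irreflexive e) (e_planar : planar R e)
  (e_C4 : C4_free e).

Section Selection.
Variables (P : pred (T * T)) (X : {set T}).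
Hypothesis Pe : forall p, P p -> [&& p.1 \in X, p.2 \in X & e p.1 p.2].
Hypothesis PN : forall u v, P (u, v) -> ~~ P (v, u).
Hypothesis X0 : X != set0.

(** [P] contains at most one orientation of each edge, so its pairs can serve as the edge type of a
    simple graph. *)
Let E : finType := {p : T * T | P p}.
Let en (x : E) (b : bool) := if b then (val x).2 else (val x).1.

Let en_simple : simple_edges en.
Proof.
split=> [[[u v] /= uv] /= h|[[u v] /= uv] [[u' v'] /= uv'] b].
  by rewrite h in uv; have := Pe uv; rewrite /= e_irr !andbF.
case: b => /= h1 h2; last by apply: val_inj; rewrite /= h1 h2.
by exfalso; have := PN uv; rewrite h1 h2 uv'.
Qed.

Let en_e (x : E) : e (en x false) (en x true).
Proof. by case: x => p Pp; case/and3P: (Pe Pp). Qed.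

Let enX (x : E) b : en x b \in X.
Proof. by case: x b => p Pp []; case/and3P: (Pe Pp). Qed.

Let cardE : #|E| = #|P|.
Proof. exact: card_sig. Qed.

Lemma planar_selection_bound : 7 * #|P| + 15 <= 15 * #|X|.
Proof.
case/set0Pn: X0 => x0 x0X.
have [F [fa [fb [ev sp]]]] := lattice_maclane en_simple (planar_lattice_drawing en_simple en_e e_planar).
by rewrite -cardE; apply: (edge_bound en_simple e_C4 e_sym en_e ev sp x0X enX).
Qed.

Lemma planar_bipartite_selection_bound (A : {set T}) :
  (forall u v, P (u, v) -> (u \in A) (+) (v \in A)) -> 2 * #|P| + 3 <= 3 * #|X|.
Proof.
move=> bip; case/set0Pn: X0 => x0 x0X.
have [F [fa [fb [ev sp]]]] := lattice_maclane en_simple (planar_lattice_drawing en_simple en_e e_planar).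
rewrite -cardE; apply: (bipartite_edge_bound en_simple e_C4 e_sym en_e ev sp x0X enX (A := A)).
by move=> [[u v] Pp]; apply: bip.
Qed.

End Selection.

Lemma planar_cnt (X : {set T}) : X != set0 -> 7 * cnt e X X + 30 <= 30 * #|X|.
Proof.
move=> X0.
(* The order of [enum_rank] orients every edge once, whereas [cnt] sees both orientations; this
   doubles the constant 15. *)
pose P (lt : rel nat) := [pred p : T * T | [&& p.1 \in X, p.2 \in X, e p.1 p.2 & lt (enum_rank p.1) (enum_rank p.2)]].
have b1 : 7 * #|P ltn| + 15 <= 15 * #|X|.
  apply: planar_selection_bound => //; first by move=> p /and4P[-> -> ->].
  by move=> u v /and4P[_ _ _ /= h]; apply/negP => /and4P[_ _ _ /=]; lia.
have sw : #|P gtn| = #|P ltn|.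
  pose s (p : T * T) := (p.2, p.1).
  have sK : involutive s by case.
  rewrite -(card_image (inv_inj sK) (P ltn)); apply: eq_card => p.
  have -> : p = s (s p) by rewrite sK.
  rewrite mem_image; last exact: inv_inj.
  by rewrite !inE /= andbCA e_sym.
have -> : cnt e X X = #|P ltn| + #|P gtn|.
  rewrite cnt_pairs -(cardID (fun p : T * T => enum_rank p.1 < enum_rank p.2)%N); congr addn.
    by apply: eq_card => p; rewrite !inE /= -!andbA.
  apply: eq_card => -[u v]; rewrite !inE /= -leqNgt leq_eqVlt andbC.
  rewrite -!andbA; do 2!congr andb; case: (boolP (e u v)) => //= uv.
  case: eqP => //= /val_inj/enum_rank_inj h; by rewrite h e_irr in uv.
rewrite sw; lia.
Qed.

Lemma planar_cnt_bipartite (X Y : {set T}) : [disjoint X & Y] -> X :|: Y != set0 ->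
  2 * cnt e X Y + 3 <= 3 * (#|X| + #|Y|).
Proof.
move=> XY XY0; have -> : #|X| + #|Y| = #|X :|: Y|.
  by rewrite cardsU disjoint_setI0// cards0 subn0.
have dY u : u \in X -> u \in Y = false by move=> uX; rewrite (disjointFr XY).
rewrite cnt_pairs; apply: (planar_bipartite_selection_bound _ _ XY0 (A := X)).
- by move=> p /and3P[h1 h2 ->]; rewrite !inE h1 h2 orbT.
- move=> u v /and3P[/= uX vY _]; apply/negP => /and3P[/= vX _ _].
  by rewrite (dY v vX) in vY.
- move=> u v /and3P[/= uX vY _]; rewrite uX; case: (boolP (v \in X)) => // /dY.
  by rewrite vY.
Qed.

End PlanarBounds.

Lemma no_cycle4_C4_free (T : finType) (e : rel T) :
  symmetric e -> irreflexive e -> ~ has_cycle_of_length e 4 -> C4_free e.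
Proof.
move=> e_sym e_irr noC4 u v a b uv ab ua ub va vb; apply: noC4.
exists [:: u; a; v; b]; split=> //; apply/andP; split.
  by rewrite /= ua (e_sym a v) va vb e_sym ub.
have neq x y : e x y -> x != y by apply: contraTneq => ->; rewrite e_irr.
by rewrite /= !inE !negb_or (neq _ _ ua) uv (neq _ _ ub) ab (neq _ _ vb) eq_sym (neq _ _ va).
Qed.

(** * Colourings with classes of prescribed size *)

Section Coloring.
Variable T : finType.
Implicit Types (e : rel T) (S X Y A B V N : {set T}) (c : T -> nat).

Definition nbrs e Y u := [set v in Y | e u v].

Definition indep e X := {in X &, forall u v, ~~ e u v}.

Definition classof S c i := [set u in S | c u == i].

Definition proper_on e S c := {in S &, forall u v, e u v -> c u != c v}.

Definition colorable e S k :=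
  exists2 c, {in S, forall u, c u < k} & proper_on e S c.

(* |S| = k t is implied. *)
Definition eqcol e S k t :=
  exists c, [/\ {in S, forall u, c u < k}, proper_on e S c
    & forall i, i < k -> #|classof S c i| = t].

Lemma cntE e X Y : cnt e X Y = \sum_(u in X) #|nbrs e Y u|.
Proof. by []. Qed.

Lemma card_setIdE (I : finType) (A : {set I}) (P : pred I) :
  #|[set v in A | P v]| = \sum_(v in A) P v.
Proof.
rewrite -sum1dep_card big_mkcondr /=; apply: eq_bigr => v _; by case: (P v).
Qed.

Lemma cnt_sym e X Y : symmetric e -> cnt e X Y = cnt e Y X.
Proof.
move=> e_sym; rewrite /cnt.
under eq_bigr do rewrite card_setIdE; under [RHS]eq_bigr do rewrite card_setIdE.
by rewrite exchange_big; apply: eq_bigr => v _; apply: eq_bigr => u _; rewrite e_sym.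
Qed.

Lemma nbrs_sub e Y Y' u : Y \subset Y' -> nbrs e Y u \subset nbrs e Y' u.
Proof. by move/subsetP=> s; apply/subsetP => v; rewrite !inE => /andP[/s -> ->]. Qed.

Lemma nbrs_le e Y Y' u : Y \subset Y' -> #|nbrs e Y u| <= #|nbrs e Y' u|.
Proof. by move=> s; apply/subset_leq_card/nbrs_sub. Qed.

Lemma cntS e e' X X' Y Y' : subrel e e' -> X \subset X' -> Y \subset Y' ->
  cnt e X Y <= cnt e' X' Y'.
Proof.
move=> ee XX YY; rewrite !cntE [X in _ <= X](big_setID X) (setIidPr XX) /=.
apply: leq_trans (leq_addr _ _); apply: leq_sum => u _.
apply: subset_leq_card; apply/subsetP => v; rewrite !inE => /andP[/(subsetP YY) -> /ee ->].
by [].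
Qed.

Lemma cntDl e X X' Y : X \subset X' -> cnt e X' Y = cnt e X Y + cnt e (X' :\: X) Y.
Proof. by move=> XX; rewrite /cnt (big_setID X) (setIidPr XX). Qed.

Lemma cntDr e X Y Y' : Y \subset Y' -> cnt e X Y' = cnt e X Y + cnt e X (Y' :\: Y).
Proof.
move=> YY; rewrite !cntE -big_split; apply: eq_bigr => u _ /=.
rewrite -(cardsID Y (nbrs e Y' u)); congr addn; apply: eq_card => v; rewrite !inE.
  by case: (boolP (v \in Y)) => [/(subsetP YY) ->|]; rewrite ?andbT ?andbF.
by rewrite andbA.
Qed.

Lemma cnt_leq e X Y d : {in X, forall u, #|nbrs e Y u| <= d} -> cnt e X Y <= d * #|X|.
Proof. by move=> h; rewrite mulnC -sum_nat_const; apply: leq_sum. Qed.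

Lemma cnt_geq e X Y d : {in X, forall u, d <= #|nbrs e Y u|} -> d * #|X| <= cnt e X Y.
Proof. by move=> h; rewrite mulnC -sum_nat_const; apply: leq_sum. Qed.

Lemma sum_classes S c k : {in S, forall u, c u < k} -> \sum_(i < k) #|classof S c i| = #|S|.
Proof.
move=> ck; rewrite -[RHS]sum1_card.
rewrite (eq_bigr (fun i : 'I_k => \sum_(u in S) (c u == i))); last first.
  by move=> i _; apply: card_setIdE.
rewrite exchange_big; apply: eq_bigr => u uS /=.
rewrite (bigD1 (Ordinal (ck u uS))) //= eqxx big1 // => i; rewrite -val_eqE /= eq_sym.
by move/negbTE ->.
Qed.

(** The added vertices are placed without regard to edges; the lemma is applied when all vertices
    outside [N] are isolated. *)
Lemma fill_classes N S c k t : N \subset S -> #|S| = k * t -> {in N, forall u, c u < k} ->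
  (forall i, i < k -> #|classof N c i| <= t) ->
  exists c', [/\ {in N, c' =1 c}, {in S, forall u, c' u < k}
    & forall i, i < k -> #|classof S c' i| = t].
Proof.
have [n] := ubnP #|S :\: N|; elim: n N c => // n IH N c sz NS cS ck le_t.
have [E0|/set0Pn[y]] := eqVneq (S :\: N) set0.
  have NE : N = S by apply/eqP; rewrite eqEsubset NS -setD_eq0 E0 eqxx.
  subst N; exists c; split=> // i ik.
  have := sum_classes ck; rewrite cS => tot.
  have le : forall j : 'I_k, true -> #|classof S c j| <= t ?= iff (#|classof S c j| == t).
    by move=> j _; split=> //; apply: le_t.
  have [_] := leqif_sum le; rewrite tot sum_nat_const card_ord eqxx => /esym/forallP.
  by move=> /(_ (Ordinal ik)) /eqP.
rewrite inE => /andP[yN yS].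
have [i ik lti] : exists2 i, i < k & #|classof N c i| < t.
  have [/existsP[i h]|/existsPn h] := boolP [exists i : 'I_k, #|classof N c i| < t].
    by exists i.
  have : k * t <= #|N|.
    rewrite -(sum_classes ck) -{1}(card_ord k) -sum_nat_const; apply: leq_sum => i _.
    by rewrite leqNgt.
  rewrite -cS leqNgt proper_card // properE NS; apply/subsetPn; by exists y.
pose c2 u := if u == y then i else c u.
have cN : {in N, c2 =1 c} by move=> u uN; rewrite /c2; case: eqP => // uy; rewrite -uy uN in yN.
have [|||||c' [c'c c'k c't]] := IH (y |: N) c2.
- have := cardsD1 y (S :\: N); rewrite inE yN yS setDDl setUC; lia.
- by apply/subUsetP; rewrite sub1set.
- by [].
- by move=> u; rewrite !inE /c2; case: eqP => //= _ /ck.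
- move=> j jk.
  have -> : classof (y |: N) c2 j = if j == i then y |: classof N c j else classof N c j.
    apply/setP => u; case: ifP => ji; rewrite !inE /c2.
      by case: (eqVneq u y) => //= _; rewrite -?(eqP ji) // eqxx.
    by case: (eqVneq u y) => [->|] //=; rewrite eq_sym ji (negbTE yN).
  case: eqP => [ji|_]; last exact: le_t.
  by rewrite cardsU1 ji; apply: leq_trans lti; rewrite -[X in _ <= X]add1n leq_add2r leq_b1.
exists c'; split=> // u uN; rewrite c'c ?cN // inE uN orbT //.
Qed.
End Coloring.

(** * Moving vertices along a chain of classes *)

Section Shifting.
Variable T : finType.
Implicit Types (e : rel T) (S X Y A B V N : {set T}) (c : T -> nat).

Lemma colorableS e S S' k : S \subset S' -> colorable e S' k -> colorable e S k.
Proof.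
move=> /subsetP SS [c ck cp]; exists c; first by move=> u /SS/ck.
by move=> u v /SS uS /SS; apply: cp.
Qed.

Lemma colorable_rel e e' S k : subrel e' e -> colorable e S k -> colorable e' S k.
Proof. by move=> ee [c ck cp]; exists c => // u v uS vS /ee; apply: cp. Qed.

Lemma indepS e X Y : X \subset Y -> indep e Y -> indep e X.
Proof. by move=> /subsetP XY i u v /XY uY /XY; apply: i. Qed.

Lemma eqcol_extend e S (R : {set T}) k t : R \subset S -> indep e R -> #|R| = t ->
  eqcol e (S :\: R) k t -> eqcol e S k.+1 t.
Proof.
move=> RS iR cR [c [ck cp ct]].
pose c' u := if u \in R then k else c u.
have c'R u : u \in R -> c' u = k by rewrite /c' => ->.
have c'N u : u \in S -> u \notin R -> c' u = c u /\ c u < k.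
  by rewrite /c' => uS uR; rewrite (negbTE uR) ck // inE uR.
exists c'; split.
- move=> u uS; case: (boolP (u \in R)) => uR; first by rewrite c'R.
  by have [-> /ltnW] := c'N u uS uR.
- move=> u v uS vS uv; case: (boolP (u \in R)) => uR; case: (boolP (v \in R)) => vR.
  + by have := iR u v uR vR; rewrite uv.
  + by rewrite (c'R u uR); have [-> /gtn_eqF ->] := c'N v vS vR.
  + by rewrite (c'R v vR); have [-> /ltn_eqF ->] := c'N u uS uR.
  + have [-> _] := c'N u uS uR; have [-> _] := c'N v vS vR; apply: cp => //; rewrite inE ?uR ?vR //.
- move=> i; rewrite ltnS leq_eqVlt => /orP[/eqP ->|ik].
    rewrite -cR; apply: eq_card => u; rewrite inE; case: (boolP (u \in R)) => uR.
      by rewrite (c'R u uR) eqxx (subsetP RS).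
    case: (boolP (u \in S)) => //= uS; have [-> /ltn_eqF ->] := c'N u uS uR; by [].
  rewrite -(ct i ik); apply: eq_card => u; rewrite !inE.
  case: (boolP (u \in R)) => uR /=; last by case: (boolP (u \in S)) => //= uS; have [-> _] := c'N u uS uR.
  by rewrite (c'R u uR) (gtn_eqF ik) andbF.
Qed.

Definition movable e S c x (i j : nat) :=
  [exists u in S :\ x, (c u == i) && [forall v in S :\ x, (c v == j) ==> ~~ e u v]].

Lemma movableP e S c x i j :
  reflect (exists u, [/\ u \in S :\ x, c u = i & {in S :\ x, forall v, c v = j -> ~~ e u v}])
    (movable e S c x i j).
Proof.
apply: (iffP existsP) => [[u /and3P[uS /eqP ci /forallP h]]|[u [uS ci h]]].
  exists u; split=> // v vS vj; have := h v; by rewrite vS vj eqxx.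
exists u; rewrite uS ci eqxx /=; apply/forallP => v; apply/implyP => vS.
by apply/implyP => /eqP; apply: h.
Qed.

Lemma classof_rem S c x i : x \in S ->
  #|classof S c i| = (c x == i) + #|classof (S :\ x) c i|.
Proof.
move=> xS; rewrite (cardsD1 x) inE xS /=; congr addn.
by apply: eq_card => u; rewrite !inE andbA.
Qed.

(** [x] enters class [i] and the movable vertex [u] leaves it, so that [u] is now the vertex to be
    placed, in class [j], and all sizes are as before. Since the chain does not return to class [i],
    its later moves remain valid. The class [i0] has the free place. *)
Lemma shift_along_path e S k t c x (i i0 : 'I_k) (p : seq 'I_k) :
  symmetric e -> irreflexive e ->
  x \in S -> {in S :\ x, forall u, c u < k} -> proper_on e (S :\ x) c ->
  (forall j : 'I_k, #|classof (S :\ x) c j| + (j == i0) = t) ->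
  {in S :\ x, forall v, c v = i -> ~~ e x v} ->
  path (fun a b : 'I_k => movable e S c x a b) i p -> uniq (i :: p) -> last i p = i0 ->
  eqcol e S k t.
Proof.
move=> e_sym e_irr.
elim: p c x i => [|j p IH] c x i xS ck cp ct xi.
  move=> _ _ /= ii0; pose c' u := if u == x then i : nat else c u.
  have c'c u : u != x -> c' u = c u by rewrite /c' => /negbTE ->.
  have c'x : c' x = i by rewrite /c' eqxx.
  exists c'; split.
  - move=> u uS; have [->|ux] := eqVneq u x; first by rewrite c'x.
    by rewrite c'c // ck // !inE ux.
  - move=> u v uS vS uv; have [ux|ux] := eqVneq u x; have [vx|vx] := eqVneq v x.
    + by rewrite ux vx e_irr in uv.
    + have vS' : v \in S :\ x by rewrite !inE vx.
      rewrite ux c'x c'c // eq_sym; apply/eqP => vi; have := xi v vS' vi.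
      by rewrite -ux uv.
    + have uS' : u \in S :\ x by rewrite !inE ux.
      rewrite vx c'x c'c //; apply/eqP => ui; have := xi u uS' ui.
      by rewrite -vx e_sym uv.
    + by rewrite !c'c //; apply: cp; rewrite ?inE ?ux ?vx.
  - move=> j jk; rewrite (classof_rem _ _ xS) c'x -(ct (Ordinal jk)) -ii0 -val_eqE /= addnC eq_sym; congr (_ + _).
    by apply: eq_card => u; rewrite !inE; case: (eqVneq u x) => //= ux; rewrite c'c.
move=> /= /andP[/movableP[u [uS ui uj]] pth] /andP[ijp up] lp.
have [ux uS'] : u != x /\ u \in S by move: uS; rewrite !inE => /andP.
pose c' v := if v == x then i : nat else c v.
have c'x : c' x = i by rewrite /c' eqxx.
have c'c v : v != x -> c' v = c v by rewrite /c' => /negbTE ->.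
have sizes l : #|classof (S :\ u) c' l| = #|classof (S :\ x) c l|.
  have := classof_rem c' l uS'; rewrite c'c // ui; rewrite (classof_rem c' l xS) c'x.
  have -> : classof (S :\ x) c' l = classof (S :\ x) c l.
    by apply/setP => v; rewrite !inE; case: (eqVneq v x) => //= vx; rewrite c'c.
  by move/eqP; rewrite eqn_add2l => /eqP.
apply: (IH c' u j uS') => //.
- move=> v; rewrite !inE => /andP[vu vS]; have [->|vx] := eqVneq v x; first by rewrite c'x.
  by rewrite c'c // ck // !inE vx.
- move=> v w; rewrite !inE => /andP[vu vS] /andP[wu wS] vw.
  have [vx|vx] := eqVneq v x; have [wx|wx] := eqVneq w x.
  + by rewrite vx wx e_irr in vw.
  + rewrite vx c'x c'c // eq_sym; apply/eqP => wi.
    have := xi w; rewrite !inE wx wS => /(_ isT wi); by rewrite -vx vw.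
  + rewrite wx c'x c'c //; apply/eqP => vi.
    have := xi v; rewrite !inE vx vS => /(_ isT vi); by rewrite -wx e_sym vw.
  + by rewrite !c'c //; apply: cp; rewrite ?inE ?vx ?wx.
- by move=> l; rewrite sizes.
- move=> v; rewrite !inE => /andP[vu vS]; have [->|vx] := eqVneq v x.
    by rewrite c'x => /val_inj ij; rewrite ij inE eqxx in ijp.
  by rewrite c'c // => vj; apply: uj; rewrite // !inE vx.
- have in_jp l : (l \in j :: p) -> l != i by move=> lp'; apply: contra ijp => /eqP <-.
  move: pth; apply: (sub_in_path (P := mem (j :: p))); last by apply/allP.
  move=> a b /in_jp ai /in_jp bi /movableP[w [wS wa wb]]; apply/movableP; exists w.
  have [wx wS'] : w != x /\ w \in S by move: wS; rewrite !inE => /andP.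
  have wu : w != u by apply: contra ai => /eqP wu; rewrite -val_eqE /= -wa wu ui.
  split; first by rewrite !inE wu.
    by rewrite c'c.
  move=> v; rewrite !inE => /andP[vu vS]; have [->|vx] := eqVneq v x.
    by rewrite c'x => /val_inj ib; rewrite ib eqxx in bi.
  by rewrite c'c // => vb; apply: wb; rewrite // !inE vx.
Qed.
End Shifting.

(** * Accessible classes *)

Section Accessibility.
Variable T : finType.
Implicit Types (e : rel T) (S X Y A B V N : {set T}) (c : T -> nat).

(* The situation left when no chain of moves makes room for x: a colour classes,
   with union A, can pass a vertex on to the short class V, and each remaining
   vertex of S has a neighbour in every one of them. *)
Record stuck e S k t x a A V : Prop := Stuck {
  st_xS : x \in S;
  st_AS : A \subset S;
  st_xA : x \notin A;
  st_cA : #|A| + 1 = a * t;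
  st_VA : V \subset A;
  st_cV : #|V| + 1 = t;
  st_V : indep e V;
  st_a : 0 < a;
  st_B : {in S :\: A, forall y, a <= #|nbrs e A y|};
  st_BV : {in S :\: A, forall y, exists2 v, v \in V & e y v};
  st_two : a = 2 -> indep e (A :\: V) /\
    exists2 w, w \in A :\: V & {in V, forall v, ~~ e w v};
  st_col : colorable e ((S :\: A) :\ x) k.-1 }.

Lemma eqcol_or_stuck_at e S k t x c : symmetric e -> irreflexive e -> #|S| = k * t ->
  x \in S -> {in S, forall u, c u < k} -> proper_on e (S :\ x) c ->
  (forall i, i < k -> #|classof S c i| = t) ->
  eqcol e S k t \/ exists a A V, stuck e S k t x a A V.
Proof.
move=> e_sym e_irr cS xS ck cp ct.
pose i0 : 'I_k := Ordinal (ck x xS).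
pose r : rel 'I_k := fun i j => movable e S c x i j.
pose acc := [set i | connect r i i0].
pose col u : 'I_k := insubd i0 (c u).
have colE u : u \in S -> val (col u) = c u by move=> uS; rewrite insubdK //; apply: (ck _).
have i0acc : i0 \in acc by rewrite inE connect0.
have S'S u : u \in S :\ x -> u \in S by rewrite inE => /andP[].
have size i : #|classof (S :\ x) c i| + (i == c x) = (if i < k then t else #|classof S c i|).
  by case: ifP => [/ct <-|_]; rewrite (classof_rem c i xS) eq_sym addnC.
have [/existsP[i /andP[iacc /forallP xi]]|/existsPn xall] :=
    boolP [exists i in acc, [forall v in S :\ x, (c v == val i) ==> ~~ e x v]].
  left; move: (iacc); rewrite inE => /connectP[p pth lp].
  case: (shortenP pth) lp => p' pth' up' _ lp.
  apply: (shift_along_path (i := i) (i0 := i0) e_sym e_irr xS _ cp _ _ pth' up' (esym lp)).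
  - by move=> u /S'S; apply: (ck _).
  - by move=> j; have := size j; rewrite ltn_ord => <-.
  - by move=> v vS vi; have := xi v; rewrite vS vi eqxx.
right.
pose A := [set u in S :\ x | col u \in acc].
pose V := classof (S :\ x) c i0.
have AS' u : u \in A -> u \in S :\ x by rewrite inE => /andP[].
have VA : V \subset A.
  apply/subsetP => u; rewrite !inE => /andP[/andP[ux uS] /eqP ui].
  by rewrite ux uS /= (_ : col u = i0) ?connect0 //; apply: val_inj; rewrite colE.
have B_nbr y : y \in S :\: A -> forall i, i \in acc -> exists v, [/\ v \in A, col v = i & e y v].
  move=> /setDP[yS yA] i iacc.
  suff [v vS [vi yv]] : exists2 v, v \in S :\ x & c v = i /\ e y v.
    have coli : col v = i by apply: val_inj; rewrite colE // S'S.
    by exists v; split=> //; rewrite inE vS coli.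
  have [yx|yx] := eqVneq y x.
    have := xall i; rewrite iacc /= => /forallPn[v]; rewrite negb_imply => /andP[vS].
    by rewrite negb_imply negbK => /andP[/eqP vi xv]; exists v; rewrite // yx.
  have [/exists_inP[v vS /andP[/eqP vi yv]]|none] :=
    boolP [exists v in S :\ x, (c v == i) && e y v]; first by exists v.
  (* Otherwise [y] could itself move to class [i], which would make its own class accessible. *)
  case/negP: yA; rewrite 3!inE yx yS inE /=.
  apply: (@connect_trans _ _ i); last by rewrite inE in iacc.
  apply: connect1; apply/movableP; exists y; rewrite colE //; split=> //; first by rewrite !inE yx.
  move=> v vS vi; apply: contra none => yv; apply/exists_inP; exists v => //.
  by rewrite vi eqxx.
have cA : #|A| + 1 = #|acc| * t.
  have -> : #|A| = \sum_(i in acc) #|classof (S :\ x) c i|.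
    rewrite -sum1_card (partition_big col (mem acc)) /=; last by move=> u; rewrite inE => /andP[].
    apply: eq_bigr => i iacc; rewrite -sum1_card; apply: eq_bigl => u.
    rewrite !inE; case: (boolP (u \in S)) => uS; rewrite ?andbF //= -val_eqE /= colE // !andbT.
    case: (eqVneq u x) => //= _; case: eqP => ui; rewrite ?andbF // andbT.
    by rewrite (_ : col u = i) ?inE in iacc *; [|apply: val_inj; rewrite colE].
  have -> : 1 = \sum_(i in acc) (i == i0 :> nat).
    rewrite (bigD1 i0) //= eqxx big1 // => i /andP[_ /negbTE]; by rewrite -val_eqE /= => ->.
  by rewrite -big_split -sum_nat_const; apply: eq_bigr => i _ /=; have := size i; rewrite ltn_ord.
exists #|acc|, A, V; split.
- by [].
- by apply/subsetP => u /AS'/S'S.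
- by rewrite inE !inE eqxx.
- exact: cA.
- exact: VA.
- by have := size i0; rewrite ltn_ord eqxx.
- move=> u v; rewrite !inE => /andP[/andP[ux uS] /eqP ui] /andP[/andP[vx vS] /eqP vi].
  by apply/negP => /cp; rewrite !inE ux uS vx vS ui vi eqxx => /(_ isT isT).
- by rewrite card_gt0; apply/set0Pn; exists i0.
- move=> y yB; apply: leq_trans (leq_imset_card col _); apply: subset_leq_card.
  apply/subsetP => i iacc; have [v [vA <- yv]] := B_nbr y yB i iacc.
  by apply: imset_f; rewrite inE vA.
- move=> y yB; have [v [vA vi yv]] := B_nbr y yB i0 i0acc; exists v => //.
  by rewrite inE AS' //= -colE ?S'S ?AS' // vi.
- move=> a2; have [j jacc ji0] : exists2 j, j \in acc & j != i0.
    have : #|acc :\ i0| = 1 by have := cardsD1 i0 acc; rewrite i0acc a2; lia.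
    by case/eqP/cards1P => j /setP/(_ j); rewrite !inE eqxx => /andP[? ?]; exists j; rewrite ?inE.
  have accE l : l \in acc -> l = i0 \/ l = j.
    have : #|acc :\ i0 :\ j| = 0.
      have := cardsD1 i0 acc; rewrite i0acc a2; have := cardsD1 j (acc :\ i0); rewrite !inE ji0.
      by move: jacc; rewrite inE => ->; lia.
    move=> /eqP; rewrite cards_eq0 => /eqP/setP/(_ l); rewrite !inE.
    by have [->|] := eqVneq l j; [right|have [->|] := eqVneq l i0; [left|move=> _ _ /= ->]].
  have W_E u : (u \in A :\: V) = (u \in S :\ x) && (c u == j).
    rewrite !inE; case: (boolP (u \in S)) => uS; rewrite ?andbF //= andbT.
    case: (eqVneq u x) => //= _; apply/andP/eqP => [[ui uacc]|uj].
      have [|ci|<-] := accE (col u); [by rewrite inE| |by rewrite colE].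
      by rewrite -colE // ci eqxx in ui.
    have cj : col u = j by apply: val_inj; rewrite colE.
    by rewrite uj cj; split=> //; move: jacc; rewrite inE.
  split.
  + move=> u v; rewrite !W_E => /andP[uS /eqP uj] /andP[vS /eqP vj].
    by apply/negP => /(cp _ _ uS vS); rewrite uj vj eqxx.
  + have rj : r j i0.
      move: (jacc); rewrite inE => /connectP[p]; elim: p => [|l p IH] /=.
        by move=> _ ij; rewrite ij eqxx in ji0.
      move=> /andP[jl pth] lp; have : l \in acc by rewrite inE; apply/connectP; exists p.
      by case/accE => lE; [rewrite -lE|apply: IH; rewrite -lE].
    have /movableP[w [wS wj wi]] := rj; exists w; first by rewrite W_E wS wj eqxx.
    by move=> v; rewrite inE => /andP[vS /eqP vi]; apply: wi.
(* Outside [A] the colour [i0] occurs at most at [x], so it can replace the last colour. *)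
- exists (fun u => if c u == k.-1 then i0 : nat else c u).
    move=> u; rewrite !inE => /andP[ux /andP[uA uS]].
    have ui : c u != i0.
      by apply: contra uA => /eqP ui; rewrite ux uS (_ : col u = i0) ?connect0 //; apply: val_inj; rewrite colE.
    have := ck u uS; have := ltn_ord i0; case: eqP => [ck1|ck1] /=; move: ui; rewrite ?ck1 /=; lia.
  have c_neq u : u \in (S :\: A) :\ x -> c u != i0.
    rewrite !inE => /andP[ux /andP[uA uS]].
    by apply: contra uA => /eqP ui; rewrite ux uS (_ : col u = i0) ?connect0 //; apply: val_inj; rewrite colE.
  move=> u v uB vB uv; have nu := c_neq u uB; have nv := c_neq v vB.
  have : c u != c v by move: uB vB; rewrite !inE => /andP[ux /andP[_ uS]] /andP[vx /andP[_ vS]]; apply: cp; rewrite // !inE ?ux ?vx.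
  by case: (c u =P k.-1) => [->|cu]; case: (c v =P k.-1) => [->|cv]; rewrite ?eqxx // => _; rewrite eq_sym.
Qed.
End Accessibility.

(** * Sparse graphs *)

Section Sparse.
Variables (T : finType) (m : nat).
Implicit Types (e : rel T) (S X Y A B U V N : {set T}) (c : T -> nat).

(* All that is used of planarity; it is inherited by subgraphs. *)
Record sparse e : Prop := Sparse {
  sp_sym : symmetric e;
  sp_irr : irreflexive e;
  sp_C4 : C4_free e;
  sp_cnt : forall X, X != set0 -> 7 * cnt e X X + 30 <= 30 * #|X|;
  sp_bip : forall X Y, [disjoint X & Y] -> X :|: Y != set0 ->
    2 * cnt e X Y + 3 <= 3 * (#|X| + #|Y|);
  sp_deg : forall X u, #|nbrs e X u| <= m }.

Lemma sparse_sub e e' : sparse e -> symmetric e' -> subrel e' e -> sparse e'.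
Proof.
move=> [sy ir c4 ct bp dg] sy' sub; split=> //.
- by move=> u; apply/negbTE; apply: contraFN (ir u) => /sub.
- by move=> u v a b uv ab /sub ? /sub ? /sub ? /sub ?; apply: (c4 u v a b).
- move=> X X0; apply: leq_trans (ct X X0); rewrite leq_add2r leq_mul2l /=.
  exact: cntS.
- move=> X Y XY XY0; apply: leq_trans (bp X Y XY XY0); rewrite leq_add2r leq_mul2l /=.
  exact: cntS.
- move=> X u; apply: leq_trans (dg X u); apply: subset_leq_card.
  by apply/subsetP => v; rewrite !inE => /andP[-> /sub].
Qed.

Definition support e S := [set u in S | 0 < #|nbrs e S u|].

Lemma support_sub e S : support e S \subset S.
Proof. by apply/subsetP => u; rewrite inE => /andP[]. Qed.

Lemma cnt_support e S : symmetric e -> cnt e (support e S) (support e S) = cnt e S S.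
Proof.
move=> sy; rewrite (cntDl e S (support_sub e S)) [X in _ = _ + X]big1 ?addn0; last first.
  move=> u; rewrite !inE => /andP[+ uS]; rewrite uS /= -eqn0Ngt => /eqP; exact.
rewrite (cntDr e _ (support_sub e S)) [X in _ = _ + X]big1 ?addn0 // => u uN.
apply/eqP; rewrite cards_eq0 -subset0; apply/subsetP => v; rewrite !inE => /andP[/andP[vN vS] uv].
case/negP: vN; rewrite vS card_gt0; apply/set0Pn; exists u.
by rewrite inE sy uv (subsetP (support_sub e S)).
Qed.

(** Minimality of the degree of [x] is recorded because it turns a <= deg x into a lower bound for
    all positive degrees. *)
Lemma eqcol_or_stuck e S k t : sparse e -> #|S| = k * t ->
  (forall e', sparse e' -> subrel e' e -> cnt e' S S < cnt e S S -> eqcol e' S k t) ->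
  eqcol e S k t \/ exists x a A V, stuck e S k t x a A V /\
    {in support e S, forall y, #|nbrs e S x| <= #|nbrs e S y|}.
Proof.
move=> sp cS IH; have sy := sp_sym sp; have ir := sp_irr sp.
have [N0|/set0Pn[x0 x0N]] := eqVneq (support e S) set0.
  left; have [||c [_ ck ct]] := @fill_classes T set0 S (fun _ => 0) k t (sub0set _) cS.
  - by move=> u; rewrite inE.
  - by move=> i _; rewrite [classof _ _ _](_ : _ = set0) ?cards0 //; apply/setP => u; rewrite !inE.
  exists c; split=> // u v uS vS uv; have /setP/(_ u) := N0; rewrite !inE uS /= card_gt0.
  by move/negbFE/eqP/setP/(_ v); rewrite !inE vS uv.
have [x /= xN xmin] := @arg_minnP _ x0 [in support e S] (fun u => #|nbrs e S u|) x0N.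
have [xS xpos] : x \in S /\ 0 < #|nbrs e S x| by move: xN; rewrite inE => /andP.
pose e' u v := [&& e u v, u != x & v != x].
have sub : subrel e' e by move=> u v /and3P[].
have sy' : symmetric e' by move=> u v; rewrite /e' sy [(u != x) && _]andbC.
have lt : cnt e' S S < cnt e S S.
  rewrite !cntE [X in X < _](bigD1 x) // [X in _ < X](bigD1 x) //= -addSn; apply: leq_add.
    rewrite (_ : nbrs e' S x = set0) ?cards0 //; apply/setP => v.
    by rewrite !inE /e' eqxx /= !andbF.
  apply: leq_sum => u _; apply: subset_leq_card; apply/subsetP => v.
  by rewrite !inE => /andP[-> /sub].
have [c [ck cp ct]] := IH e' (sparse_sub sp sy' sub) sub lt.
have cp' : proper_on e (S :\ x) c.
  by move=> u v; rewrite !inE => /andP[ux uS] /andP[vx vS] uv; apply: cp; rewrite // /e' uv ux.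
case: (eqcol_or_stuck_at sy ir cS xS ck cp' ct) => [|[a [A [V st]]]]; first by left.
by right; exists x, a, A, V; split=> // y yN; apply: xmin.
Qed.

Section Stuck.
Variables (e : rel T) (S : {set T}) (k t : nat) (x : T) (a : nat) (A V : {set T}).
Hypotheses (sp : sparse e) (cS : #|S| = k * t) (st : stuck e S k t x a A V).
Hypothesis xmin : {in support e S, forall y, #|nbrs e S x| <= #|nbrs e S y|}.
Let B := S :\: A.

Lemma stuck_xB : x \in B.
Proof. by rewrite inE (st_xA st) (st_xS st). Qed.

Lemma stuck_cardB : #|B| + a * t = k * t + 1.
Proof.
have := cardsID A S; rewrite (setIidPr (st_AS st)) cS.
have := st_cA st; rewrite -/B; lia.
Qed.

Lemma stuck_dis : [disjoint A & B].
Proof. by rewrite -setI_eq0; apply/eqP/setP => u; rewrite /B !inE; case: (u \in A). Qed.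

Lemma stuck_cntB : a * #|B| <= cnt e B A.
Proof. by apply: cnt_geq => u uB; apply: (st_B st). Qed.

Lemma stuck_bip : 2 * (a * #|B|) + 3 <= 3 * (k * t).
Proof.
have dis : [disjoint B & A] by rewrite disjoint_sym stuck_dis.
have := sp_bip sp dis; rewrite -cS => /(_ _)/leq_trans.
have -> : #|B| + #|A| = #|S| by rewrite addnC -(cardsID A S) (setIidPr (st_AS st)).
move=> h; apply: leq_trans (h _ _ _) => //; last by apply/set0Pn; exists x; rewrite inE stuck_xB.
by rewrite leq_add2r leq_mul2l stuck_cntB.
Qed.

Lemma stuck_a_deg : a <= #|nbrs e S x|.
Proof. by apply: leq_trans (st_B st stuck_xB) _; apply: nbrs_le; apply: st_AS st. Qed.

Lemma stuck_support_deg : a * #|support e S| <= cnt e S S.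
Proof.
rewrite (cntDl e S (support_sub e S)); apply: leq_trans (leq_addr _ _).
by apply: cnt_geq => u uN; apply: leq_trans stuck_a_deg (xmin uN).
Qed.

Lemma stuck_B_support : B \subset support e S.
Proof.
apply/subsetP => y yB; rewrite inE; have /setDP[-> _] := yB.
have [v vV yv] := st_BV st yB; rewrite card_gt0; apply/set0Pn; exists v.
by rewrite inE yv (subsetP (st_AS st)) // (subsetP (st_VA st)).
Qed.

(** On the support the average degree is below 30/7, hence the least degree is at most 4. *)
Lemma stuck_deg4 : #|nbrs e S x| <= 4.
Proof.
have N0 : support e S != set0 by apply/set0Pn; exists x; rewrite (subsetP stuck_B_support) // stuck_xB.
have := sp_cnt sp N0; rewrite (cnt_support _ (sp_sym sp)).
have : #|nbrs e S x| * #|support e S| <= cnt e S S.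
  rewrite (cntDl e S (support_sub e S)); apply: leq_trans (leq_addr _ _).
  by apply: cnt_geq.
have : 0 < #|support e S| by rewrite card_gt0.
clear; nia.
Qed.

Lemma stuck_a4 : a <= 4.
Proof. exact: leq_trans stuck_a_deg stuck_deg4. Qed.

(** Sharper than [stuck_bip] when [A] has many isolated vertices. With [stuck_support_deg] it
    excludes a = 4 for m = 7 at the levels m - 1 and m - 2. *)
Lemma stuck_support_bip : 2 * (a * #|B|) + 3 <= 3 * #|support e S|.
Proof.
pose A' := A :&: support e S.
have dis : [disjoint B & A'].
  rewrite disjoint_sym; apply: disjointWl stuck_dis; exact: subsetIl.
have NE : #|B| + #|A'| = #|support e S|.
  rewrite addnC -(cardsID A (support e S)) setIC; congr (_ + _); apply: eq_card => u.
  by rewrite !inE; case: (boolP (u \in A)) => //= uA; have := subsetP stuck_B_support u; rewrite !inE uA /=; case: (u \in S) => // /(_ isT).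
rewrite -NE; apply: leq_trans (sp_bip sp dis _); last first.
  by apply/set0Pn; exists x; rewrite inE stuck_xB.
rewrite leq_add2r leq_mul2l /=; apply: leq_trans stuck_cntB _.
rewrite (cntDr e B (subsetIl A (support e S))) [X in _ + X]big1 ?addn0 // => u uB.
apply/eqP; rewrite cards_eq0 -subset0; apply/subsetP => v; rewrite !inE => /andP[/andP[vN vA] uv].
have vS := subsetP (st_AS st) v vA; case/negP: vN; rewrite vA vS card_gt0.
apply/set0Pn; exists u; rewrite inE (sp_sym sp) uv andbT; by case/setDP: uB.
Qed.

Lemma stuck_cntS : cnt e S S = cnt e A A + 2 * cnt e B A + cnt e B B.
Proof.
rewrite (cntDl e S (st_AS st)) (cntDr e A (st_AS st)) (cntDr e (S :\: A) (st_AS st)) -/B.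
rewrite (cnt_sym A B (sp_sym sp)) mul2n -addnn; clear; lia.
Qed.

End Stuck.

Section Swap.
Variables (e : rel T) (U B : {set T}) (t : nat).
Hypotheses (sp : sparse e) (UB : [disjoint U & B]) (iU : indep e U) (cU : #|U| + 1 = t).

(** If [y1] were adjacent to both [y2] and [y3], then w, y2, y1, y3 would be a 4-cycle. *)
Lemma solo_pair w (N : {set T}) : {in N, forall z, e w z} -> 2 < #|N| ->
  exists z z', [/\ z \in N, z' \in N, z != z' & ~~ e z z'].
Proof.
move=> Nw /card_gt2P[y1 [y2 [y3 [[n1 n2 n3] [d12 d23 d31]]]]].
case: (boolP (e y1 y2)) => [e12|]; last by exists y1, y2.
case: (boolP (e y1 y3)) => [e13|]; last by exists y1, y3; split=> //; rewrite eq_sym.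
case: (sp_C4 sp (u := w) (v := y1) (a := y2) (b := y3)) => //; try exact: Nw.
by apply: contraTneq (Nw _ n1) => ->; rewrite (sp_irr sp).
Qed.

(* w leaves U and two of its solo neighbours enter. *)
Lemma swap_solo_pair w z z' : w \in U -> z \in B -> z' \in B -> z != z' -> ~~ e z z' ->
  nbrs e U z = [set w] -> nbrs e U z' = [set w] ->
  let U' := z |: (z' |: (U :\ w)) in let B' := w |: (B :\ z :\ z') in
  [/\ indep e U', #|U'| = t, (U :|: B) :\: U' = B', U' \subset U :|: B
    & cnt e B' B' + 4 <= cnt e B B + 2 * m].
Proof.
move=> wU zB z'B zz' nzz' zw z'w U' B'.
have dU u : u \in B -> u \notin U by move=> uB; rewrite (disjointFl UB).
have dB u : u \in U -> u \notin B by move=> uU; rewrite (disjointFr UB).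
have zn u : u \in U -> u != w -> ~~ e z u.
  by move=> uU uw; apply/negP => zu; have /setP/(_ u) := zw; rewrite !inE uU zu (negbTE uw).
have z'n u : u \in U -> u != w -> ~~ e z' u.
  by move=> uU uw; apply/negP => zu; have /setP/(_ u) := z'w; rewrite !inE uU zu (negbTE uw).
have wz : e w z by have /setP/(_ w) := zw; rewrite !inE eqxx wU (sp_sym sp).
have wz' : e w z' by have /setP/(_ w) := z'w; rewrite !inE eqxx wU (sp_sym sp).
split.
- move=> u v; rewrite !inE => /or3P[/eqP->|/eqP->|/andP[uw uU]] /or3P[/eqP->|/eqP->|/andP[vw vU]].
  + by rewrite (sp_irr sp).
  + by [].
  + exact: zn.
  + by rewrite (sp_sym sp).
  + by rewrite (sp_irr sp).
  + exact: z'n.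
  + by rewrite (sp_sym sp); apply: zn.
  + by rewrite (sp_sym sp); apply: z'n.
  + exact: iU.
- rewrite /U' !cardsU1 !inE !negb_or zz' !negb_and (dU z) // (dU z') // !orbT /=.
  have := cardsD1 w U; rewrite wU -cU; lia.
- apply/setP => u; rewrite !inE.
  have [->|uw] := eqVneq u w.
    rewrite wU !andbT /=; apply/negP => /or3P[/eqP wz0|/eqP wz0|//].
      by have := dB _ wU; rewrite wz0 zB.
    by have := dB _ wU; rewrite wz0 z'B.
  have [->|uz] := eqVneq u z; first by rewrite andbF.
  have [->|uz'] := eqVneq u z' => //=.
  case: (boolP (u \in U)) => //= uU; by rewrite (negbTE (dB _ uU)).
- apply/subsetP => u; rewrite !inE => /or3P[/eqP->|/eqP->|/andP[_ ->//]].
    by rewrite zB orbT.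
  by rewrite z'B orbT.
have wB0 : w \notin B :\ z :\ z' by rewrite !inE (negbTE (dB _ wU)) !andbF.
(* [w] joins the rest without its neighbours [z] and [z']; counted in both directions, they give the
   4 in the statement. *)
have nw : #|nbrs e (B :\ z :\ z') w| + 2 <= m.
  apply: leq_trans (sp_deg sp B w).
  have := cardsD1 z (nbrs e B w); rewrite inE zB wz => ->.
  have := cardsD1 z' (nbrs e B w :\ z); rewrite !inE z'B wz' eq_sym zz' => ->.
  rewrite addnCA addnA addnC leq_add2l; apply: subset_leq_card; apply/subsetP => u.
  by rewrite !inE => /andP[/and3P[-> -> ->] ->].
have : cnt e (B :\ z :\ z') (B :\ z :\ z') <= cnt e B B.
  by apply: cntS => //; apply: subset_trans (subsetDl _ _) (subsetDl _ _).
have -> : cnt e B' B' = cnt e (B :\ z :\ z') (B :\ z :\ z') + 2 * #|nbrs e (B :\ z :\ z') w|.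
  have c1 Y : cnt e [set w] Y = #|nbrs e Y w| by rewrite cntE big_set1.
  have s1 : [set w] \subset B' by rewrite sub1set !inE eqxx.
  have -> : cnt e B' B' = cnt e [set w] B' + cnt e (B :\ z :\ z') B'.
    rewrite (cntDl e B' s1); congr (_ + cnt _ _ _).
    by rewrite /B' setU1K.
  have B'D : B' :\: [set w] = B :\ z :\ z' by rewrite /B' setU1K.
  rewrite (cntDr e [set w] s1) (cntDr e (B :\ z :\ z') s1) B'D.
  rewrite (cnt_sym (B :\ z :\ z') [set w] (sp_sym sp)) !c1.
  rewrite (_ : nbrs e [set w] w = set0) ?cards0; last first.
    by apply/setP => u; rewrite !inE; case: eqP => // ->; rewrite (sp_irr sp).
  lia.
lia.
Qed.

(** If no vertex of [B] can simply join [U], then 2 |B| is at most m |U| plus the number of vertices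
    with exactly one neighbour in [U]. So there are more than 2 |U| of these, and some [w] in [U] is
    adjacent to three of them. *)
Lemma extract_class : 1 < m -> (m + 2) * #|U| < 2 * #|B| ->
  exists U', [/\ U' \subset U :|: B, indep e U', #|U'| = t
    & cnt e ((U :|: B) :\: U') ((U :|: B) :\: U') + 4 <= cnt e B B + 2 * m].
Proof.
move=> m1 big.
have [/existsP[y /andP[yB /eqP y0]]|/existsPn Bn] := boolP [exists y in B, nbrs e U y == set0].
  have yn u : u \in U -> ~~ e y u.
    by move=> uU; apply/negP => yu; have /setP/(_ u) := y0; rewrite !inE uU yu.
  have yU : y \notin U by rewrite (disjointFl UB).
  exists (y |: U); split.
  - by rewrite subUset sub1set inE yB orbT subsetUl.
  - move=> u v; rewrite !inE => /orP[/eqP->|uU] /orP[/eqP->|vU]; rewrite ?(sp_irr sp) //.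
    + exact: yn.
    + by rewrite (sp_sym sp); apply: yn.
    + exact: iU.
  - by rewrite cardsU1 yU -cU addnC.
  - have : cnt e ((U :|: B) :\: (y |: U)) ((U :|: B) :\: (y |: U)) <= cnt e B B.
      have s : (U :|: B) :\: (y |: U) \subset B.
        by apply/subsetP => u; rewrite !inE negb_or => /andP[/andP[_ /negbTE ->]].
      exact: cntS.
    lia.
pose solo := [set y in B | #|nbrs e U y| == 1].
have solo_card : 2 * #|B| <= cnt e B U + #|solo|.
  have -> : #|solo| = \sum_(y in B) (#|nbrs e U y| == 1) by apply: card_setIdE.
  rewrite cntE -big_split mulnC -sum_nat_const; apply: leq_sum => y yB /=.
  have := Bn y; rewrite yB /= -cards_eq0 /nbrs.
  by case: #|_| => [|[|?]].
have solo_sum : #|solo| = \sum_(w in U) #|[set y in solo | e w y]|.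
  have -> : #|solo| = cnt e solo U.
    rewrite cntE -sum1_card; apply: eq_bigr => y; rewrite inE => /andP[_ /eqP]; exact.
  by rewrite (cnt_sym _ _ (sp_sym sp)).
have [w wU w3] : exists2 w, w \in U & 2 < #|[set y in solo | e w y]|.
  have [/exists_inP//|/exists_inPn none] := boolP [exists w in U, 2 < #|[set y in solo | e w y]|].
  exfalso.
  have : #|solo| <= 2 * #|U|.
    rewrite solo_sum mulnC -sum_nat_const; apply: leq_sum => w wU.
    by rewrite leqNgt none.
  have : cnt e B U <= m * #|U|.
    by rewrite (cnt_sym _ _ (sp_sym sp)); apply: cnt_leq => u _; apply: sp_deg.
  lia.
have [|z [z' [zN z'N zz' nzz']]] := solo_pair (w := w) _ w3.
  by move=> z; rewrite inE => /andP[].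
have solo_nbr y : y \in [set y in solo | e w y] -> nbrs e U y = [set w].
  rewrite 2!inE => /andP[/andP[_ /cards1P[w' /[dup] nE ->]] wy].
  by have /setP/(_ w) := nE; rewrite !inE wU (sp_sym sp) wy => /esym/eqP ->.
have inB y : y \in [set y in solo | e w y] -> y \in B by rewrite 2!inE => /andP[/andP[]].
have [h1 h2 h3 h4 h5] := swap_solo_pair wU (inB _ zN) (inB _ z'N) zz' nzz' (solo_nbr _ zN) (solo_nbr _ z'N).
by exists (z |: (z' |: (U :\ w))); rewrite h3.
Qed.

End Swap.
End Sparse.

(** * Colouring sparse graphs *)

Section Levels.
Variables (T : finType) (m : nat).
Implicit Types (e : rel T) (S X Y A B U V N : {set T}) (c : T -> nat).

(** If all positive degrees are at least 4, the support has at most t vertices, and any proper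
    colouring of it can be filled up. Otherwise a <= 3 < k, so a (k - a) >= 3, and the edges between
    [A] and [B] alone contribute more than 6 t to [cnt]. *)
Lemma eqcol_of_colorable e S k t : sparse m e -> 3 < k -> #|S| = k * t -> cnt e S S <= 4 * t ->
  colorable e S k -> eqcol e S k t.
Proof.
move=> + k3 cS; have [n] := ubnP (cnt e S S); elim: n e => // n IH e lt sp le4 col.
case: (eqcol_or_stuck sp cS) => [e' sp' sub lt'|//|[x [a [A [V [st xmin]]]]]].
  apply: IH => //; [by apply: leq_trans lt' _|by apply: leq_trans (ltnW lt') _|exact: colorable_rel col].
have [d4|d3] := leqP 4 #|nbrs e S x|.
  have cN : #|support e S| <= t.
    have : 4 * #|support e S| <= cnt e S S.
      rewrite (cntDl e S (support_sub e S)); apply: leq_trans (leq_addr _ _).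
      by apply: cnt_geq => u uN; apply: leq_trans d4 (xmin u uN).
    by move=> /leq_trans/(_ le4); rewrite leq_mul2l.
  have [c ck cp] := col.
  have [||c' [c'c c'k c't]] := fill_classes (support_sub e S) cS (c := c).
  - by move=> u /(subsetP (support_sub e S))/ck.
  - move=> i _; apply: leq_trans cN; apply: subset_leq_card; apply/subsetP => u.
    by rewrite inE => /andP[].
  exists c'; split=> // u v uS vS uv.
  have uN : u \in support e S by rewrite inE uS card_gt0; apply/set0Pn; exists v; rewrite inE vS.
  have vN : v \in support e S by rewrite inE vS card_gt0; apply/set0Pn; exists u; rewrite inE uS (sp_sym sp).
  by rewrite !c'c //; apply: cp.
have a3 : a <= 3 by apply: leq_trans (stuck_a_deg st) _.
have a0 := st_a st.
have := stuck_cardB cS st; have := stuck_cntB st; have := stuck_cntS sp st.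
have ak : 3 * t <= a * (k - a) * t by rewrite leq_mul2r; apply/orP; right; nia.
have : a * (k - a) * t + a * (a * t) = a * (k * t) by rewrite -mulnA -mulnDr -mulnDl subnK //; lia.
by move=> h1 h2 h3 h4; exfalso; nia.
Qed.

Lemma colorable_add e X k y : sparse m e -> colorable e X k -> #|nbrs e X y| < k ->
  colorable e (y |: X) k.
Proof.
move=> sp [c ck cp] ly.
have [i ik inot] : exists2 i, i < k & i \notin [seq c u | u in nbrs e X y].
  have [/existsP[i h]|/existsPn h] := boolP [exists i : 'I_k, val i \notin [seq c u | u in nbrs e X y]].
    by exists i.
  have : k <= #|nbrs e X y|.
    rewrite -(size_iota 0 k) -(size_image c (nbrs e X y)); apply: uniq_leq_size (iota_uniq _ _) _.
    move=> i; rewrite mem_iota add0n => /andP[_ ik]; have := h (Ordinal ik); by rewrite negbK.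
  by rewrite leqNgt ly.
have iN v : v \in X -> e y v -> c v != i.
  by move=> vX yv; apply: contra inot => /eqP <-; apply: image_f; rewrite inE vX.
exists (fun u => if u == y then i else c u).
  by move=> u; rewrite !inE; case: eqP => //= _ /ck.
move=> u v; rewrite !inE; case: (eqVneq u y) => [->|uy] /=; case: (eqVneq v y) => [->|vy] /=.
- by rewrite (sp_irr sp).
- by move=> _ vX yv; rewrite eq_sym; apply: iN.
- by move=> uX _; rewrite (sp_sym sp) => yu; apply: iN.
- exact: cp.
Qed.

Lemma colorable_add_set e X (L : {set T}) k : sparse m e -> colorable e X k ->
  {in L, forall y, #|nbrs e (X :|: L) y| < k} -> colorable e (X :|: L) k.
Proof.
move=> sp; have [n] := ubnP #|L|; elim: n L X => // n IH L X sz col lL.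
have [->|/set0Pn[y yL]] := eqVneq L set0; first by rewrite setU0.
have XL : X :|: L = (y |: X) :|: (L :\ y).
  by apply/setP => u; rewrite !inE; case: eqP => [->|_] //=; rewrite yL orbT.
rewrite XL; apply: IH; first by have := cardsD1 y L; rewrite yL; lia.
- apply: colorable_add => //; apply: leq_ltn_trans (lL y yL); apply: nbrs_le; exact: subsetUl.
- by rewrite -XL => u; rewrite inE => /andP[_ /lL].
Qed.

Hypothesis m7 : 6 < m.

(** The linear bound on g through the extreme pairs (g, q) = (2, 0) and (m - 4, 4). *)
Lemma solo_weight g q : g + q <= m -> g < 3 \/ 3 < q -> 4 * g <= 8 + (m - 6) * q.
Proof.
move=> gq [g3|q3]; first by apply: leq_trans (leq_addr _ _); lia.
have : (m - 6) * 4 <= (m - 6) * q by rewrite leq_mul2l q3 orbT.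
by lia.
Qed.

(** The arithmetic of the counting in [eqcol_minus2_stuck_one]: l, h and v are the numbers of low
    vertices, high vertices and vertices of [V], and q is m - 6 times the number of edges between
    high vertices and [V]. *)
Lemma low_weight t l h v q : l + h = (m - 3) * t + 1 -> h <= t + 2 -> v + 1 = t ->
  q <= (m - 6) * (2 * t + 4) -> m <= t -> 4 * l <= 8 * v + q -> False.
Proof.
have [d ->] : exists d, m = d.+1 + 6 by exists (m - 7); lia.
rewrite addnK (_ : d.+1 + 6 - 3 = d.+1 + 3); last by lia.
move=> lh ht vt qd mt; have : d.+1 * 2 <= d.+1 * t by rewrite leq_mul2l; apply/orP; right; lia.
move: qd lh; rewrite mulnDr mulnDl mulnCA; lia.
Qed.

(* Each vertex outside V is low (one neighbour in V, at most two elsewhere) or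
   high. By counting, some w in V has three low neighbours and at most three high
   ones; after swapping w with two of the former, the rest can be properly
   coloured in the order: high vertices, w, low vertices. *)
Lemma eqcol_minus2_stuck_one e S t x V : sparse m e -> m <= t -> #|S| = (m - 2) * t ->
  cnt e S S <= 2 * ((m - 2) * t + 3) -> stuck e S (m - 2) t x 1 V V ->
  #|nbrs e S x| <= 4 -> eqcol e S (m - 2) t.
Proof.
move=> sp mt cS le st dx.
have m23 : m - 2 = (m - 3).+1 by lia.
have k4 : 3 < m - 3 by lia.
have m23' : m - 3 = (m - 2).-1 by lia.
pose B := S :\: V.
have UB : [disjoint V & B] := stuck_dis S V.
have VS := st_AS st.
have mt7 : 7 * t <= m * t by rewrite leq_mul2r m7 orbT.
have cB : #|B| = (m - 3) * t + 1.
  have := stuck_cardB cS st; rewrite mul1n -/B !mulnBl; lia.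
have cV := st_cV st.
have VV0 : cnt e V V = 0.
  rewrite /cnt big1 // => u uV; apply/eqP; rewrite cards_eq0 -subset0; apply/subsetP => v.
  by rewrite inE => /andP[vV uv]; have := st_V st uV vV; rewrite uv.
have cc := stuck_cntS sp st; rewrite -/B VV0 add0n in cc.
pose n y := #|nbrs e V y|; pose b y := #|nbrs e B y|.
have n1 y : y \in B -> 0 < n y by move=> yB; have := st_B st yB.
pose low := [set y in B | (n y == 1) && (b y <= 2)].
pose high := B :\: low.
have lowB : low \subset B by apply/subsetP => y; rewrite inE => /andP[].
have highB : high \subset B by apply: subsetDl.
have high_cases y : y \in high -> 2 <= n y \/ 3 <= b y.
  move=> /setDP[yB]; rewrite inE yB /= negb_and => /orP[n2|b3]; last by right; rewrite ltnNge.
  by left; have := n1 y yB; lia.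
have c1E : cnt e B V = \sum_(y in B) n y by [].
have c2E : cnt e B B = \sum_(y in B) b y by [].
(* Both [h1] and [h2] rest on 3 n + b >= 6 at a high vertex, where n >= 2 or b >= 3. *)
have h1 : 3 * #|B| + 3 * #|high| <= 3 * cnt e B V + cnt e B B.
  rewrite c1E c2E big_distrr -big_split /= (big_setID high) /= (setIidPr highB).
  rewrite -{1}(cardsID high B) (setIidPr highB).
  rewrite (_ : 3 * _ + _ = #|high| * 6 + #|B :\: high| * 3); last by lia.
  rewrite -!sum_nat_const; apply: leq_add; apply: leq_sum => y yh.
    have /setDP[/n1 ny _] := yh; case: (high_cases y yh); lia.
  by have /setDP[/n1 ny _] := yh; lia.
have h2 : 6 * #|B| + 3 * cnt e high V <= 6 * cnt e B V + cnt e B B.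
  rewrite c1E c2E [6 * \sum_(y in B) _]big_distrr -big_split /= (big_setID high) /= (setIidPr highB).
  rewrite -{1}(cardsID high B) (setIidPr highB).
  rewrite (_ : 6 * _ + _ = (#|high| * 6 + 3 * cnt e high V) + #|B :\: high| * 6); last by lia.
  rewrite cntE [3 * \sum_(u in high) _]big_distrr -!sum_nat_const -big_split /=; apply: leq_add; apply: leq_sum => y yh.
    have /setDP[/n1 ny _] := yh; rewrite -/(n y); case: (high_cases y yh); lia.
  by have /setDP[/n1 ny _] := yh; lia.
have lowhigh : #|low| + #|high| = #|B| by rewrite -(cardsID low B) (setIidPr lowB).
have glow : \sum_(w in V) #|nbrs e low w| = #|low|.
  rewrite -cntE (cnt_sym _ _ (sp_sym sp)) cntE -sum1_card; apply: eq_bigr => y.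
  by rewrite inE => /and3P[_ /eqP].
have qhigh : \sum_(w in V) #|nbrs e high w| = cnt e high V.
  by rewrite -cntE (cnt_sym _ _ (sp_sym sp)).
have gq w : #|nbrs e low w| + #|nbrs e high w| <= m.
  apply: leq_trans (sp_deg sp B w); rewrite -(cardsID low (nbrs e B w)); apply: leq_add;
    apply: subset_leq_card; apply/subsetP => y; rewrite !inE.
    by move=> /andP[/and3P[-> -> ->] ->].
  by move=> /andP[/andP[-> ->] ->].
have [w wV /andP[g3 q3]] : exists2 w, w \in V & (2 < #|nbrs e low w|) && (#|nbrs e high w| <= 3).
  apply/exists_inP; apply: contraT => /exists_inPn none; exfalso.
  have : 4 * #|low| <= 8 * #|V| + (m - 6) * cnt e high V.
    rewrite -glow -qhigh !big_distrr /= [8 * _]mulnC -sum_nat_const -big_split /=; apply: leq_sum => w wV.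
    by have := none w wV; rewrite negb_and -!ltnNge => /orP; apply: solo_weight.
  have Q : cnt e high V <= 2 * t + 4 by move: h2 cc le; rewrite cB !mulnBl; lia.
  have Hh : #|high| <= t + 2 by move: h1 cc le; rewrite cB !mulnBl; lia.
  have Qm : (m - 6) * cnt e high V <= (m - 6) * (2 * t + 4) by rewrite leq_mul2l Q orbT.
  by rewrite cB in lowhigh; apply: low_weight lowhigh Hh cV Qm mt.
have [|z [z' [zN z'N zz' nzz']]] := solo_pair sp (w := w) _ g3.
  by move=> z; rewrite inE => /andP[].
have low_solo y : y \in nbrs e low w -> nbrs e V y = [set w].
  rewrite 2!inE => /andP[/and3P[_ /cards1P[w' /[dup] nE ->] _] wy].
  by have /setP/(_ w) := nE; rewrite !inE wV (sp_sym sp) wy => /esym/eqP ->.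
have inB y : y \in nbrs e low w -> y \in B by rewrite 2!inE => /andP[/andP[]].
have [iU' cU' DU' U'S cB'] := swap_solo_pair sp UB (st_V st) cV wV (inB _ zN) (inB _ z'N) zz' nzz' (low_solo _ zN) (low_solo _ z'N).
set U' := z |: _ in iU' cU' DU' U'S; set B' := w |: _ in DU' cB'.
have VBS : V :|: B = S by rewrite /B setDE setUIr setUCr setIT; apply/setUidPr.
rewrite VBS in DU' U'S.
rewrite m23; apply: (eqcol_extend U'S iU' cU'); rewrite DU'; apply: eqcol_of_colorable => //.
- by have := cardsID U' S; rewrite (setIidPr U'S) cU' cS DU' m23 mulSn => /addnI.
(* [cnt e B B] is at most 2 t + 4 and the swap adds at most 2 m - 4, so m <= t yields 4 t. *)
- move: le cB'; rewrite cc; have := stuck_cntB st; rewrite -/B cB.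
  move: (cnt e B V) (cnt e B B) (cnt e B' B') => c1 c2 c3; rewrite m23 mulSn.
  by move: mt m7; clear; lia.
have col0 : colorable e (high :\ x) (m - 3).
  by rewrite m23'; apply: colorableS (st_col st); apply: setSD; apply: subsetDl.
(* [x] has degree at most 4 and a neighbour in [V], hence at most 3 neighbours in [B], fewer than m
   - 3. *)
have col1 : colorable e high (m - 3).
  case: (boolP (x \in high)) => xh; last first.
    by apply: colorableS col0; apply/subsetP => u uh; rewrite !inE andbC; apply/andP; split; [move: uh; rewrite !inE|apply: contraNneq xh => <-].
  rewrite -(setD1K xh); apply: colorable_add => //.
  apply: (@leq_ltn_trans (b x)).
    by apply: nbrs_le; apply: subset_trans (subsetDl _ _) (subsetDl _ _).
  have /setDP[xB _] := xh; have nx := n1 x xB.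
  have nbx : n x + b x <= #|nbrs e S x|.
    rewrite -(cardsID V (nbrs e S x)); apply: leq_add; apply: subset_leq_card; apply/subsetP => y.
      by rewrite !inE => /andP[yV ->]; rewrite yV (subsetP VS).
    by rewrite !inE => /andP[/andP[-> ->] ->].
  by move: nx (leq_trans nbx dx) k4; clear; lia.
have col2 : colorable e (w |: high) (m - 3) by apply: colorable_add => //; apply: leq_ltn_trans q3 _.
have col3 : colorable e ((w |: high) :|: low) (m - 3).
  apply: colorable_add_set => // y; rewrite inE => /and3P[yB _ b2].
  have s : nbrs e ((w |: high) :|: low) y \subset w |: nbrs e B y.
    apply/subsetP => u; rewrite !inE => /andP[/orP[/orP[->//|/andP[_ ->]]|/andP[-> _]] ->]; by rewrite orbT.
  apply: leq_ltn_trans (subset_leq_card s) _; rewrite cardsU1 -/(b y).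
  by apply: leq_ltn_trans (leq_add (leq_b1 _) b2) _.
apply: colorableS col3; apply/subsetP => u; rewrite in_setU1 in_setU in_setU1.
case/orP=> [->//|]; rewrite !in_setD1 => /and3P[_ _ uB].
by rewrite [u \in high]in_setD uB; case: (u \in low); rewrite ?orbT.
Qed.

(** For a > 1 the contribution 2 a |B|, with |B| = (m - 2 - a) t + 1, exceeds the bound on [cnt],
    except for a = 4 and m = 7, where the bounds on the support decide. *)
Lemma eqcol_minus2 e S t : sparse m e -> m <= t -> #|S| = (m - 2) * t ->
  cnt e S S <= 2 * ((m - 2) * t + 3) -> eqcol e S (m - 2) t.
Proof.
move=> + mt cS; have [n] := ubnP (cnt e S S); elim: n e => // n IH e lt sp le.
case: (eqcol_or_stuck sp cS) => [e' sp' sub lt'|//|[x [a [A [V [st xmin]]]]]].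
  by apply: IH => //; [apply: leq_trans lt' _|apply: leq_trans (ltnW lt') _].
have mt7 : 7 * t <= m * t by rewrite leq_mul2r m7 orbT.
have cB := stuck_cardB cS st; have cBA := stuck_cntB st; have cc := stuck_cntS sp st.
have a4 := stuck_a4 sp st xmin; have a0 := st_a st.
have supb := stuck_support_bip sp st; have supd := stuck_support_deg st xmin.
have [a1|[a2|[a3|a4']]] : a = 1 \/ a = 2 \/ a = 3 \/ a = 4 by lia.
- have AV : A = V.
    apply/esym/eqP; rewrite eqEcard (st_VA st) /=; have := st_cA st; have := st_cV st; rewrite a1; lia.
  by subst a A; apply: (eqcol_minus2_stuck_one sp mt cS le st); apply: stuck_deg4 sp st xmin.
- by exfalso; subst a; move: cB cBA cc le; rewrite !mulnBl; lia.
- by exfalso; subst a; move: cB cBA cc le; rewrite !mulnBl; lia.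
- exfalso; subst a; have [m8|m8] := leqP 8 m.
    have : 8 * t <= m * t by rewrite leq_mul2r m8 orbT.
    by move: cB cBA cc le; rewrite !mulnBl; lia.
  have m_7 : m = 7 by lia.
  by move: cB cBA cc le supb supd; rewrite m_7; lia.
Qed.

Lemma stuck_one e S k t x A V : stuck e S k t x 1 A V -> A = V.
Proof.
move=> st; apply/esym/eqP; rewrite eqEcard (st_VA st) /=.
have := st_cA st; have := st_cV st; lia.
Qed.

(* With two accessible classes, moving w into V makes a full class. *)
Lemma stuck_two e S k t x A V : sparse m e -> stuck e S k t x 2 A V ->
  exists w, let R := w |: V in let U := (A :\: V) :\ w in
  [/\ R \subset A, indep e R, #|R| = t, indep e U & [/\ #|U| + 1 = t, S :\: R = U :|: (S :\: A)
     & [disjoint U & S :\: A]]].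
Proof.
move=> sp st; have [iW [w wW wV]] := st_two st (erefl _); exists w => R U.
have /setDP[wA wnV] := wW.
have RA : R \subset A by rewrite subUset sub1set wA (st_VA st).
have cR : #|R| = t by rewrite cardsU1 wnV -(st_cV st) addnC.
split=> //.
- move=> u v; rewrite !inE => /orP[/eqP->|uV] /orP[/eqP->|vV]; rewrite ?(sp_irr sp) ?wV //.
    by rewrite (sp_sym sp) wV.
  exact: (st_V st).
- by apply: indepS iW; apply: subsetDl.
split.
- have := cardsD1 w (A :\: V); rewrite wW -/U; have := cardsID V A; rewrite (setIidPr (st_VA st)).
  have := st_cA st; have := st_cV st; lia.
- apply/setP => u; rewrite /U !inE negb_or; case: (boolP (u \in A)) => uA; rewrite ?andbF ?andbT ?orbF /=.
    by rewrite (subsetP (st_AS st)) // andbT.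
  have -> : u \notin V by apply: contra uA; apply: (subsetP (st_VA st)).
  by rewrite (_ : u != w) //; apply: contraNneq uA => ->.
- by rewrite -setI_eq0; apply/eqP/setP => u; rewrite /U !inE; case: (u \in A); rewrite ?andbF.
Qed.

(** All k t + 1 vertices outside [V] have a neighbour in [V], so deleting [V] removes at least that
    many edges; completing [V] gives back at most m - 2. *)
Lemma stuck_extract e S k t x V : sparse m e -> #|S| = k.+1 * t -> stuck e S k.+1 t x 1 V V ->
  (m + 2) * t <= 2 * (k * t) + m + 3 ->
  exists U', [/\ U' \subset S, indep e U', #|U'| = t, #|S :\: U'| = k * t
    & cnt e (S :\: U') (S :\: U') + 2 * (k * t) + 6 <= cnt e S S + 2 * m].
Proof.
move=> sp cS st big.
have cB := stuck_cardB cS st; have cBA := stuck_cntB st; have cc := stuck_cntS sp st.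
have cV := st_cV st.
have [||U' [U'S iU' cU' le]] := extract_class sp (stuck_dis S V) (st_V st) cV.
- lia.
- nia.
have VBS : V :|: (S :\: V) = S by rewrite setDE setUIr setUCr setIT; apply/setUidPr; apply: st_AS st.
rewrite VBS in U'S le; exists U'; split=> //.
  by have := cardsID U' S; rewrite (setIidPr U'S) cU' cS; lia.
by move: cB cBA cc le; rewrite !mul1n mulSn; lia.
Qed.

(* The bound is what 7 * cnt <= 30 (m t - 1) becomes when extract_class removes a
   class from m t vertices; the bound of eqcol_minus2 has slack for both ways of
   removing a further class, or two classes at once when m = 7. *)
Lemma eqcol_minus1 e S t : sparse m e -> m <= t -> #|S| = (m - 1) * t ->
  7 * cnt e S S + 72 <= 16 * (m * t) + 14 * t + 14 * m -> eqcol e S (m - 1) t.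
Proof.
have -> : m - 1 = (m - 2).+1 by lia.
move=> + mt cS; have [n] := ubnP (cnt e S S); elim: n e => // n IH e lt sp le.
case: (eqcol_or_stuck sp cS) => [e' sp' sub lt'|//|[x [a [A [V [st xmin]]]]]].
  apply: IH => //; [apply: leq_trans lt' _ => //|].
  by apply: leq_trans le; rewrite leq_add2r leq_mul2l ltnW.
have mt7 : 7 * t <= m * t by rewrite leq_mul2r m7 orbT.
have mm7 : 7 * m <= m * t by rewrite mulnC leq_mul2l (leq_trans m7 mt) orbT.
have cB := stuck_cardB cS st; have cBA := stuck_cntB st; have cc := stuck_cntS sp st.
have a4 := stuck_a4 sp st xmin; have a0 := st_a st; have bip := stuck_bip sp cS st.
have supb := stuck_support_bip sp st; have supd := stuck_support_deg st xmin.
have [a1|[a2|[a3|a4']]] : a = 1 \/ a = 2 \/ a = 3 \/ a = 4 by lia.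
- subst a; have AV := stuck_one st; subst A.
  have [|U' [U'S iU' cU' cSU le']] := stuck_extract sp cS st.
    by rewrite !mulnBl mulnDl; lia.
  apply: (eqcol_extend U'S iU' cU'); apply: eqcol_minus2 => //.
  have : 7 * (cnt e (S :\: U') (S :\: U')) <= 7 * (2 * ((m - 2) * t + 3)); last by rewrite leq_mul2l.
  have : (12 * m - 70) * m <= (12 * m - 70) * t by rewrite leq_mul2l mt orbT.
  (* This is (m - 7) (m - 8) >= 0. *)
  have : 15 * m <= m * m + 56 by have [d ->] : exists d, m = d + 7; [exists (m - 7); lia|clear; nia].
  move: le le'; rewrite !mulnBl -!mulnA; lia.
- subst a; have [w [RA iR cR iU [cU SR dis]]] := stuck_two sp st.
  set R := w |: V in RA iR cR SR.
  have RS : R \subset S := subset_trans RA (st_AS st).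
  apply: (eqcol_extend RS iR cR); apply: eqcol_minus2 => //.
    by have := cardsID R S; rewrite (setIidPr RS) cR cS; lia.
  have : cnt e S S = cnt e R R + 2 * cnt e (S :\: R) R + cnt e (S :\: R) (S :\: R).
    rewrite (cntDl e S RS) (cntDr e R RS) (cntDr e (S :\: R) RS).
    by rewrite (cnt_sym R (S :\: R) (sp_sym sp)); lia.
  have : #|S :\: A| <= cnt e (S :\: R) R.
    apply: (@leq_trans (cnt e (S :\: A) V)); last first.
      by apply: cntS => //; [apply: setDS|apply: subsetUr].
    rewrite -[X in X <= _]mul1n; apply: cnt_geq => y yB; have [v vV yv] := st_BV st yB.
    by rewrite card_gt0; apply/set0Pn; exists v; rewrite inE vV.
  have : 7 * (cnt e (S :\: R) (S :\: R)) <= 7 * (2 * ((m - 2) * t + 3)) ->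
    cnt e (S :\: R) (S :\: R) <= 2 * ((m - 2) * t + 3) by rewrite leq_mul2l.
  move=> fin h1 h2; apply: fin.
  have [m8|m8] := leqP 8 m.
    have : 8 * t <= m * t by rewrite leq_mul2r m8 orbT.
    have : (12 * m - 84) * m <= (12 * m - 84) * t by rewrite leq_mul2l mt orbT.
    move: le cB h1 h2; rewrite !mulSn !mulnBl; nia.
  have m_7 : m = 7 by lia.
  by move: le cB h1 h2; rewrite m_7; lia.
- by exfalso; subst a; move: cB bip; rewrite !mulSn !mulnBl; lia.
- exfalso; subst a; have [m8|m8] := leqP 8 m.
    have : 8 * t <= m * t by rewrite leq_mul2r m8 orbT.
    by move: cB bip; rewrite !mulSn !mulnBl; lia.
  have m_7 : m = 7 by lia.
  by move: cB cBA cc le supb supd; rewrite m_7; lia.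
Qed.

(** As |B| = (m - a) t + 1, the bipartite bound reads 2 a ((m - a) t + 1) + 3 <= 3 m t. It fails for
    a = 3 and a = 4, and for a = 2 it leaves only m = 7 with t >= 7. *)
Lemma eqcol_max_degree e S t : sparse m e -> #|S| = m * t -> eqcol e S m t.
Proof.
move=> + cS; have [n] := ubnP (cnt e S S); elim: n e => // n IH e lt sp.
case: (eqcol_or_stuck sp cS) => [e' sp' sub lt'|//|[x [a [A [V [st xmin]]]]]].
  by apply: IH => //; apply: leq_trans lt' _.
have mt7 : 7 * t <= m * t by rewrite leq_mul2r m7 orbT.
have cB := stuck_cardB cS st; have cBA := stuck_cntB st; have cc := stuck_cntS sp st.
have a4 := stuck_a4 sp st xmin; have a0 := st_a st; have bip := stuck_bip sp cS st.
have le : 7 * cnt e S S + 30 <= 30 * (m * t).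
  by rewrite -cS; apply: (sp_cnt sp); apply/set0Pn; exists x; apply: st_xS st.
have m1E : m = (m - 1).+1 by lia.
have m2E : m - 1 = (m - 2).+1 by lia.
have [a1|[a2|[a3|a4']]] : a = 1 \/ a = 2 \/ a = 3 \/ a = 4 by lia.
- subst a; have AV := stuck_one st; subst A.
  (* Each of the (m - 1) t + 1 vertices of [B] sends an edge to [V], which receives at most m (t -
     1). The lower levels take m <= t from here. *)
  have mt : m < t.
    have : cnt e (S :\: V) V <= m * #|V|.
      by rewrite (cnt_sym _ _ (sp_sym sp)); apply: cnt_leq => u _; apply: sp_deg.
    have := st_cV st; move: cB cBA; nia.
  rewrite m1E in cS st; have [|U' [U'S iU' cU' cSU le']] := stuck_extract sp cS st.
    by rewrite !mulnBl mulnDl; lia.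
  rewrite m1E; apply: (eqcol_extend U'S iU' cU'); apply: eqcol_minus1 => //; first exact: ltnW.
  by move: le le'; rewrite !mulnBl; lia.
- have t7 : 7 <= t /\ m = 7.
    have [m8|m8] := leqP 8 m.
      have : 8 * t <= m * t by rewrite leq_mul2r m8 orbT.
      by move: cB bip; rewrite a2; lia.
    have m_7 : m = 7 by lia.
    by split=> //; move: cB bip; rewrite a2 m_7; lia.
  have [t7' m_7] := t7.
  subst a; have [w [RA iR cR iU [cU SR dis]]] := stuck_two sp st.
  set R := w |: V in RA iR cR SR; set U := _ :\ w in iU cU SR dis.
  have RS : R \subset S := subset_trans RA (st_AS st).
  rewrite m1E; apply: (eqcol_extend RS iR cR).
  (* [U], the second accessible class without [w], again has t - 1 vertices and can be completed
     too, so two classes are removed at once. *)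
  have [||U' [U'S iU' cU' le']] := extract_class sp dis iU cU; first by lia.
    by move: cB; rewrite m_7; lia.
  rewrite -SR in U'S le'.
  rewrite m2E; apply: (eqcol_extend U'S iU' cU'); apply: eqcol_minus2 => //; first by lia.
    have := cardsID R S; rewrite (setIidPr RS) cR cS; have := cardsID U' (S :\: R).
    by rewrite (setIidPr U'S) cU' m_7; lia.
  by move: le le' cB cBA cc; rewrite m_7; lia.
- by exfalso; subst a; move: cB bip; lia.
- by exfalso; subst a; move: cB bip; lia.
Qed.

End Levels.

(** * Orders not divisible by m: vertices of low degree *)

Section Divisibility.
Variables (T : finType) (m : nat).
Hypothesis m7 : 6 < m.
Implicit Types (e : rel T) (S X Y : {set T}).

Definition balcol e S t :=
  exists c, [/\ {in S, forall u, c u < m}, proper_on e S c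
    & forall i, i < m -> t <= #|classof S c i| <= t.+1].

Lemma sparse_low_degree e S : sparse m e -> S != set0 ->
  exists2 x, x \in S & #|nbrs e S x| <= 4.
Proof.
move=> sp S0; apply/exists_inP; apply: contraT => /exists_inPn none; exfalso.
have := sp_cnt sp S0; have : 5 * #|S| <= cnt e S S.
  by apply: cnt_geq => u /none; rewrite -ltnNge.
lia.
Qed.

(** When [x] returns, at most r classes have t + 1 vertices and at most 4 contain neighbours of [x];
    r + 5 <= m leaves a class for it. *)
Lemma balcol_peel e S r t : sparse m e -> r + 4 <= m -> #|S| = m * t + r -> balcol e S t.
Proof.
move=> sp; elim: r S => [|r IH] S r4 cS.
  rewrite addn0 in cS; have [c [ck cp ct]] := eqcol_max_degree m7 sp cS.
  by exists c; split=> // i /ct ->; rewrite leqnn leqnSn.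
have S0 : S != set0 by rewrite -card_gt0; lia.
have [x xS x4] := sparse_low_degree sp S0.
have cSx : #|S :\ x| = m * t + r by have := cardsD1 x S; rewrite xS; lia.
have [|c [ck cp ct]] := IH (S :\ x) _ cSx; first by lia.
pose full := [set i : 'I_m | #|classof (S :\ x) c i| != t].
pose seen := [set i : 'I_m | val i \in [seq c u | u in nbrs e (S :\ x) x]].
have cfull : #|full| <= r.
  have := sum_classes ck; rewrite cSx => tot.
  have : m * t + #|full| <= \sum_(i < m) #|classof (S :\ x) c i|.
    have -> : #|full| = \sum_(i < m) (#|classof (S :\ x) c i| != t).
      rewrite -sum1_card big_mkcond; apply: eq_bigr => i _; rewrite inE.
      by case: (_ != _).
    rewrite -{1}(card_ord m) -sum_nat_const -big_split; apply: leq_sum => i _ /=.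
    by have := ct i (ltn_ord i); case: eqP => /= [->|]; lia.
  by rewrite tot leq_add2l.
have cseen : #|seen| <= 4.
  apply: leq_trans x4; apply: leq_trans (nbrs_le e x (subsetDl S [set x])).
  have m0 : 0 < m by lia.
  apply: leq_trans (leq_imset_card (fun u => insubd (Ordinal m0) (c u)) _).
  apply: subset_leq_card; apply/subsetP => i; rewrite inE => /imageP[u uN iu].
  by apply/imsetP; exists u => //; apply: val_inj; rewrite insubdK -?iu //; apply: (ltn_ord i).
have [i iN] : exists i, i \notin full :|: seen.
  apply/existsP; apply: contraT; rewrite negb_exists => /forallP all.
  have : #|full :|: seen| = m.
    by rewrite -[RHS](card_ord m) -cardsT; apply: eq_card => j; have := all j; rewrite negbK [RHS]in_setT => ->.
  by have := leq_card_setU full seen; rewrite /leqif => -[]; lia.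
move: iN; rewrite !inE negb_or negbK => /andP[/eqP it iseen].
have iN v : v \in S :\ x -> e x v -> c v != i.
  by move=> vS xv; apply: contra iseen => /eqP vi; apply/imageP; exists v; rewrite // inE vS.
pose c' u := if u == x then i : nat else c u.
have c'x : c' x = i by rewrite /c' eqxx.
have c'c u : u != x -> c' u = c u by rewrite /c' => /negbTE ->.
exists c'; split.
- move=> u uS; have [->|ux] := eqVneq u x; first by rewrite c'x.
  by rewrite c'c // ck // !inE ux.
- move=> u v uS vS uv; have [ux|ux] := eqVneq u x; have [vx|vx] := eqVneq v x.
  + by rewrite ux vx (sp_irr sp) in uv.
  + by rewrite ux c'x c'c // eq_sym; apply: iN; rewrite ?inE ?vx // -ux.
  + by rewrite vx c'x c'c //; apply: iN; rewrite ?inE ?ux // -vx (sp_sym sp).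
  + by rewrite !c'c //; apply: cp; rewrite ?inE ?ux ?vx.
- move=> j jm; rewrite (classof_rem c' j xS) c'x.
  have -> : classof (S :\ x) c' j = classof (S :\ x) c j.
    by apply/setP => u; rewrite !inE; case: (eqVneq u x) => //= ux; rewrite c'c.
  case: eqP => [<-|_]; first by rewrite it; lia.
  exact: ct.
Qed.

End Divisibility.

(** * Orders not divisible by m: an added clique *)

Section DisjointTriangle.
Variables (T : finType) (m : nat) (e : rel T).
Hypotheses (m7 : 6 < m) (sp : sparse m e).

Definition add_triangle (a b : T + 'I_3) : bool :=
  match a, b with
  | inl u, inl v => e u v
  | inr i, inr j => i != j
  | _, _ => false
  end.

Let lpart (X : {set T + 'I_3}) : {set T} := [set u | inl u \in X].
Let rpart (X : {set T + 'I_3}) : {set 'I_3} := [set i | inr i \in X].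

Let card_parts (X : {set T + 'I_3}) : #|X| = #|lpart X| + #|rpart X|.
Proof.
have sizeE (I : finType) (A : {set I}) : #|A| = \sum_i (i \in A).
  by rewrite -sum1_card big_mkcond; apply: eq_bigr => i _; case: (_ \in _).
rewrite !sizeE big_sumType /=.
by congr (_ + _); apply: eq_bigr => u _; rewrite inE.
Qed.

Let nbrs_inl (Y : {set T + 'I_3}) u : #|nbrs add_triangle Y (inl u)| = #|nbrs e (lpart Y) u|.
Proof.
rewrite card_parts (_ : rpart _ = set0) ?cards0 ?addn0.
  by apply: eq_card => v; rewrite !inE.
by apply/setP => i; rewrite !inE andbF.
Qed.

Let nbrs_inr (Y : {set T + 'I_3}) i : #|nbrs add_triangle Y (inr i)| = #|rpart Y :\ i|.
Proof.
rewrite card_parts (_ : lpart _ = set0) ?cards0 ?add0n.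
  by apply: eq_card => j; rewrite !inE eq_sym andbC.
by apply/setP => v; rewrite !inE andbF.
Qed.

Let cnt_parts (X Y : {set T + 'I_3}) : cnt add_triangle X Y =
  cnt e (lpart X) (lpart Y) + \sum_(i in rpart X) #|rpart Y :\ i|.
Proof.
rewrite !cntE big_mkcond big_sumType /= [X in _ = X + _]big_mkcond [X in _ = _ + X]big_mkcond /=.
by congr (_ + _); apply: eq_bigr => u _; rewrite inE ?nbrs_inl ?nbrs_inr.
Qed.

Let rpart3 X : #|rpart X| <= 3.
Proof. by rewrite -[X in _ <= X](card_ord 3); apply: max_card. Qed.

(** The additive constants 30 and 3 are needed once for a union but are available in each nonempty
    part, so disjoint unions keep the bounds; up to three clique vertices are checked by cases. *)
Lemma add_triangle_sparse : sparse m add_triangle.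
Proof.
split.
- by case=> u [] v //=; [apply: (sp_sym sp)|rewrite eq_sym].
- by case=> u /=; rewrite ?(sp_irr sp) ?eqxx.
- case=> u [] v [] a [] b //= uv ab ua ub va vb.
    by apply: (sp_C4 sp (u := u) (v := v) (a := a) (b := b)).
  have : uniq [:: u; v; a; b] by rewrite /= !inE !negb_or ua ub va vb ab andbT /= uv.
  by move=> /card_uniqP/= h; have := max_card [in [:: u; v; a; b]]; rewrite h card_ord.
- move=> X X0; rewrite cnt_parts card_parts.
  have -> : \sum_(i in rpart X) #|rpart X :\ i| = #|rpart X| * #|rpart X|.-1.
    rewrite -sum_nat_const; apply: eq_bigr => i iX.
    by have := cardsD1 i (rpart X); rewrite iX => ->.
  have X1 : 0 < #|lpart X| + #|rpart X| by rewrite -card_parts card_gt0.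
  have := rpart3 X; have [l0|l0] := eqVneq (lpart X) set0.
    move: X1; rewrite l0 /cnt big_set0 cards0; case: #|_| => [|[|[|[|?]]]] //.
  have := sp_cnt sp l0; case: #|rpart X| => [|[|[|[|?]]]] //=; lia.
- move=> X Y XY XY0; rewrite cnt_parts !card_parts.
  have disl : [disjoint lpart X & lpart Y].
    rewrite -setI_eq0; apply/eqP/setP => u; rewrite !inE; apply/negbTE; rewrite negb_and.
    by case: (boolP (inl u \in X)) => //= uX; rewrite (disjointFr XY).
  have disr : rpart X :&: rpart Y = set0.
    apply/setP => u; rewrite !inE; apply/negbTE; rewrite negb_and.
    by case: (boolP (inr u \in X)) => //= uX; rewrite (disjointFr XY).
  have r3 : #|rpart X| + #|rpart Y| <= 3.
    by rewrite -cardsUI disr cards0 addn0 -[X in _ <= X](card_ord 3); apply: max_card.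
  have le : \sum_(i in rpart X) #|rpart Y :\ i| <= #|rpart X| * #|rpart Y|.
    by rewrite -sum_nat_const; apply: leq_sum => i _; apply/subset_leq_card/subsetDl.
  have tot : 0 < (#|lpart X| + #|lpart Y|) + (#|rpart X| + #|rpart Y|).
    move: XY0; rewrite -card_gt0; have := leq_card_setU X Y; rewrite /leqif => -[+ _].
    rewrite !card_parts; lia.
  have [l0|l0] := eqVneq (lpart X :|: lpart Y) set0.
    have [-> ->] : lpart X = set0 /\ lpart Y = set0.
      by move/eqP: l0; rewrite setU_eq0 => /andP[/eqP -> /eqP ->].
    move: tot; have -> : lpart X = set0 by move/eqP: l0; rewrite setU_eq0 => /andP[/eqP -> _].
    have -> : lpart Y = set0 by move/eqP: l0; rewrite setU_eq0 => /andP[_ /eqP ->].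
    rewrite /cnt big_set0 !cards0; nia.
  have := sp_bip sp disl l0; nia.
- move=> X [u|i]; first by rewrite nbrs_inl; apply: sp_deg sp _ _.
  by rewrite nbrs_inr; apply: leq_trans (subset_leq_card (subsetDl _ _)) _; apply: leq_trans (rpart3 X) _; lia.
Qed.

Lemma balcol_add_triangle r t : m <= r + 3 -> r < m -> #|T| = m * t + r ->
  balcol m e [set: T] t.
Proof.
move=> r3 rm cT.
(* Exactly m - r vertices of the triangle are coloured, which raises the order to m (t + 1). They
   get different colours, so dropping them costs each class at most one vertex. *)
pose S' := [set a : T + 'I_3 | if a is inr i then i + r < m else true].
have cS' : #|S'| = m * t.+1.
  rewrite card_parts (_ : lpart S' = setT); last by apply/setP => u; rewrite !inE.
  rewrite cardsT cT mulnS.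
  have -> : #|rpart S'| = \sum_(i < 3) (i + r < m).
    by rewrite -sum1_card big_mkcond; apply: eq_bigr => i _; rewrite !inE; case: (_ < _).
  by rewrite !big_ord_recl big_ord0 /= /bump /=; lia.
have [c' [c'k c'p c't]] := eqcol_max_degree m7 add_triangle_sparse cS'.
exists (fun u => c' (inl u)); split.
- by move=> u _; apply: c'k; rewrite inE.
- by move=> u v _ _ uv; apply: c'p; rewrite ?inE.
move=> i im; have := c't i im; rewrite card_parts.
have -> : lpart (classof S' c' i) = classof setT (fun u => c' (inl u)) i.
  by apply/setP => u; rewrite !inE.
have : #|rpart (classof S' c' i)| <= 1.
  apply/card_le1_eqP => j j'; rewrite !inE => /andP[jS /eqP ji] /andP[j'S /eqP j'i].
  apply/eqP; apply: contraT => jj'.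
  rewrite eq_sym in jj'; by have := c'p (inr j) (inr j'); rewrite !inE jS j'S ji j'i eqxx => /(_ isT isT jj').
lia.
Qed.

End DisjointTriangle.

Lemma sparse_balcol (T : finType) (m : nat) (e : rel T) : 6 < m -> sparse m e ->
  exists t, balcol m e [set: T] t.
Proof.
move=> m7 sp; exists (#|T| %/ m).
have cT : #|T| = m * (#|T| %/ m) + #|T| %% m by rewrite {1}(divn_eq #|T| m) mulnC.
have rm : #|T| %% m < m by rewrite ltn_mod; lia.
have [r4|r3] := leqP (#|T| %% m + 4) m.
  by apply: (balcol_peel m7 sp r4); rewrite cardsT.
by apply: balcol_add_triangle m7 sp _ _ _ rm cT; lia.
Qed.

Lemma balcol_equitably_colorable (T : finType) (e : rel T) (m t : nat) :
  balcol m e [set: T] t -> equitably_colorable e m.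
Proof.
move=> [c [cm cp ct]].
have cm' u : c u < m by apply: cm; rewrite inE.
have sizeE (i : 'I_m) : color_class_size (fun u => Ordinal (cm' u)) i = #|classof setT c i|.
  by apply: eq_card => u; rewrite !inE -val_eqE.
exists (fun u => Ordinal (cm' u)); split.
  by move=> u v uv; rewrite -val_eqE; apply: cp; rewrite ?inE.
move=> i j; rewrite !sizeE.
have /andP[_ h1] := ct i (ltn_ord i); have /andP[h2 _] := ct j (ltn_ord j).
by apply: leq_trans h1 _; rewrite ltnS.
Qed.

Theorem theorem34 (R : realType) (T : finType) (e : rel T)
    (e_sym : symmetric e) (e_irr : irreflexive e)
    (e_planar : planar R e)
    (e_noC4 : ~ has_cycle_of_length e 4)
    (e_Delta : (7 <= max_degree e)%N) :
  equitably_colorable e (max_degree e).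
Proof.
have e_C4 : C4_free e := no_cycle4_C4_free e_sym e_irr e_noC4.
have sp : sparse (max_degree e) e.
  split=> //.
  - exact: planar_cnt e_sym e_irr e_planar e_C4.
  - by move=> X Y; apply: (planar_cnt_bipartite e_sym e_irr e_planar e_C4).
  - move=> X u; apply: leq_trans (leq_bigmax u).
    by apply: subset_leq_card; apply/subsetP => v; rewrite !inE => /andP[].
by have [t /balcol_equitably_colorable] := sparse_balcol e_Delta sp.
Qed.
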